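(* Let $\mathbb{X}=\{X(t)\}_{t\ge0}$ be a random cubical filtration in $\mathbb{R}^d$ that is stationary and $R$-dependent for some integer $R\ge 0$. Fix an integer $0\le q<d$ and real numbers $0\le s\le t<\infty$. Then there exists a constant $\widehat\beta_q(s,t)\in[0,\infty)$ such that \[ \frac{\mathbb{E}[\beta_q^{\mathbb{X}^n}(s,t)]}{|\Lambda^n|}\to\widehat\beta_q(s,t)\quad\text{and}\quad \frac{\beta_q^{\mathbb{X}^n}(s,t)}{|\Lambda^n|}\to\widehat\beta_q(s,t)\ \text{almost surely, as } n\to\infty. \]
   Context: Fix $d\in\mathbb{N}$. An elementary interval is $[l,l+1]$ or $\{l\}$ with $l\in\mathbb{Z}$; an elementary cube in $\mathbb{R}^d$ is a product $I_1\times\cdots\times I_d$ of elementary intervals, and its dimension is the number of nondegenerate factors $[l,l+1]$. $\mathcal{K}^d$ is the set of all elementary cubes and $\mathcal{K}^d_q$ those of dimension $q$; for a cubical set $X$, $\mathcal{K}^d_q(X)$ is the set of elementary $q$-cubes contained in $X$. A cubical set is a (possibly infinite) union of elementary cubes; it is bounded if it is a finite union. Homology $H_q(X)$ is cubical homology with real coefficients (chain groups spanned by elementary $q$-cubes in $X$, with the standard cubical boundary). A cubical filtration is an increasing family $\{X(t)\}_{t\ge0}$ of cubical sets with $X(t)=\bigcap_{t'>t}X(t')$; it is bounded if $\bigcup_t X(t)$ is bounded. For a bounded cubical filtration $\mathbb{X}$, $0\le q$ and $0\le s\le t<\infty$, the persistent Betti number $\beta_q^{\mathbb{X}}(s,t)$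 is the rank of the map $H_q(X(s))\to H_q(X(t))$ induced by inclusion. The birth time of $Q\in\mathcal{K}^d$ in $\mathbb{X}$ is $t^{\mathbb{X}}_Q=\inf\{t\ge0: Q\subset X(t)\}$ ($=\infty$ if never). A random cubical filtration is a random variable in the set of cubical filtrations equipped with the $\sigma$-field generated by the maps $\mathbb{X}\mapsto t^{\mathbb{X}}_Q$, $Q\in\mathcal{K}^d$. It is stationary if for every $z\in\mathbb{Z}^d$ the families $\{t^{\mathbb{X}}_Q\}_{Q\in\mathcal{K}^d}$ and $\{t^{\mathbb{X}}_{z+Q}\}_{Q\in\mathcal{K}^d}$ have the same law; it is $R$-dependent if for all $A,B\subset\mathbb{R}^d$ with $\inf\{\|x-y\|_{\max}:x\in A,y\in B\}>R$ the families $\{t^{\mathbb{X}}_Q: Q\subset A\}$ and $\{t^{\mathbb{X}}_Q:Q\subset B\}$ are independent. $\Lambda^n=[-n,n]^d$, $|\Lambda^n|=(2n)^d$ its Lebesgue measure, and $\mathbb{X}^n=\{X(t)\cap\Lambda^n\}_{t\ge0}$. *)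

(* Defs.v *)
From HB Require Import structures.
From mathcomp Require Import all_boot all_order all_algebra.
From mathcomp Require Import all_classical all_reals all_analysis.
From mathcomp Require Import measurable_realfun lebesgue_measure lebesgue_integral probability.
Set Implicit Arguments. Unset Strict Implicit. Unset Printing Implicit Defensive.
Import Order.TTheory GRing.Theory Num.Theory.
Local Open Scope classical_set_scope.
Local Open Scope ring_scope.

Section Cubical.
Variables (R : realType) (d : nat).

(** Elementary cube I_1 x ... x I_d : Q.1 i = l_i, and Q.2 i = true iff
    I_i = [l_i, l_i+1] (nondegenerate), false iff I_i = {l_i}. *)
Definition cube := ({ffun 'I_d -> int} * {ffun 'I_d -> bool})%type.

Definition cdim (Q : cube) : nat := #|[pred i | Q.2 i]|.

Definition cube_set (Q : cube) : set ('I_d -> R) :=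
  [set x | forall i, if Q.2 i then ((Q.1 i)%:~R <= x i /\ x i <= (Q.1 i)%:~R + 1)
                     else x i = (Q.1 i)%:~R].

Definition shift (z : 'I_d -> int) (Q : cube) : cube :=
  ([ffun i => Q.1 i + z i], Q.2).

Definition cubical_set (X : set ('I_d -> R)) :=
  exists F : set cube, X = \bigcup_(Q in F) cube_set Q.

(** cubical filtration {X(t)}_{t>=0} (values at t < 0 are irrelevant) *)
Definition cubical_filtration (X : R -> set ('I_d -> R)) :=
  [/\ forall t, 0 <= t -> cubical_set (X t),
      forall s t, 0 <= s -> s <= t -> X s `<=` X t &
      forall t, 0 <= t -> X t = \bigcap_(u in [set u | t < u]) X u].

(** birth time t_Q = inf {t >= 0 : Q ⊂ X(t)}  (= +oo if never) *)
Definition birth (X : R -> set ('I_d -> R)) (Q : cube) : \bar R :=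
  ereal_inf [set t%:E | t in [set t | 0 <= t /\ cube_set Q `<=` X t]].

Definition Lambda (n : nat) : set ('I_d -> R) :=
  [set x | forall i, - (n%:R) <= x i /\ x i <= n%:R].

Definition restrictX (X : R -> set ('I_d -> R)) (n : nat) : R -> set ('I_d -> R) :=
  fun t => X t `&` Lambda n.

(** Lebesgue measure |Lambda^n| = (2n)^d *)
Definition vol (n : nat) : R := ((2 * n) ^ d)%:R.

(** Chains are functions cube -> R; a q-chain in X is supported on the
    elementary q-cubes contained in X (finitely many when X is bounded). *)
Definition chain_in (q : nat) (X : set ('I_d -> R)) (c : cube -> R) :=
  forall Q, c Q != 0 -> cdim Q = q /\ cube_set Q `<=` X.

(** Cofaces of Q in direction i (Q degenerate at i):
    [l_i - 1, l_i] (Q is its upper face) and [l_i, l_i + 1] (Q is its lower face). *)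
Definition coface_hi (i : 'I_d) (Q : cube) : cube :=
  ([ffun j => if j == i then Q.1 j - 1 else Q.1 j],
   [ffun j => if j == i then true else Q.2 j]).
Definition coface_lo (i : 'I_d) (Q : cube) : cube :=
  (Q.1, [ffun j => if j == i then true else Q.2 j]).

(** Standard cubical boundary (Kaczynski-Mischaikow-Mrozek):
    d P = sum_m (-1)^(m-1) (P with m-th nondegenerate factor [l,l+1] replaced
    by {l+1}  minus  replaced by {l}).  Written coefficientwise:
    (d c)(Q) = sum_P [P:Q] c(P), the sum being over the finitely many cofaces P. *)
Definition bdry (c : cube -> R) : cube -> R :=
  fun Q => \sum_(i < d | ~~ Q.2 i)
     (-1) ^+ #|[pred j : 'I_d | (j < i)%N && Q.2 j]| *
     (c (coface_hi i Q) - c (coface_lo i Q)).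

Definition cycle_in (q : nat) (X : set ('I_d -> R)) (c : cube -> R) :=
  chain_in q X c /\ bdry c = (fun=> 0).

Definition boundary_in (q : nat) (X : set ('I_d -> R)) (c : cube -> R) :=
  exists b, chain_in q.+1 X b /\ c = bdry b.

(** There are k q-cycles of A whose homology classes in H_q(B) are linearly
    independent, i.e. the image of H_q(A) -> H_q(B) has dimension >= k. *)
Definition indep_image (q : nat) (A B : set ('I_d -> R)) (k : nat) :=
  exists z : 'I_k -> cube -> R,
    (forall i, cycle_in q A (z i)) /\
    forall a : 'I_k -> R,
      boundary_in q B (fun Q => \sum_(i < k) a i * z i Q) -> forall i, a i = 0.

(** rank of H_q(A) -> H_q(B) induced by inclusion (A, B bounded, A ⊆ B):
    the maximal k as above. *)
Definition rank_induced (q : nat) (A B : set ('I_d -> R)) : nat :=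
  xget 0%N [set k | indep_image q A B k /\ forall j, indep_image q A B j -> (j <= k)%N].

Definition pbetti (q : nat) (X : R -> set ('I_d -> R)) (s t : R) : nat :=
  rank_induced q (X s) (X t).

Section Random.
Context {d0 : measure_display} {Omega : measurableType d0}.
Variables (P : probability Omega R) (X : Omega -> R -> set ('I_d -> R)).

(** random cubical filtration: measurable w.r.t. the sigma-field generated by
    the birth-time maps *)
Definition random_cubical_filtration :=
  (forall w, cubical_filtration (X w)) /\
  (forall Q, measurable_fun [set: Omega] ((fun w => birth (X w) Q) : Omega -> \bar R)).

Definition family_sigma : set (set (cube -> \bar R)) :=
  smallest (sigma_algebra setT)
    [set A | exists Q (B : set (\bar R)), measurable B /\ A = [set f | B (f Q)]].

Definition same_law (f g : Omega -> cube -> \bar R) :=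
  forall A, family_sigma A -> P (f @^-1` A) = P (g @^-1` A).

Definition stationary :=
  forall z : 'I_d -> int,
    same_law (fun w Q => birth (X w) Q) (fun w Q => birth (X w) (shift z Q)).

Definition birth_sigma (A : set ('I_d -> R)) : set (set Omega) :=
  smallest (sigma_algebra setT)
    [set E | exists Q (B : set (\bar R)), cube_set Q `<=` A /\ measurable B /\
             E = (fun w => birth (X w) Q) @^-1` B].

Definition independent (F G : set (set Omega)) :=
  forall E E', F E -> G E' -> (P (E `&` E') = P E * P E')%E.

Definition dist_max (A B : set ('I_d -> R)) : \bar R :=
  ereal_inf [set r%:E | r in [set r | exists x y, A x /\ B y /\
                        r = \big[Num.max/0]_(i < d) `|x i - y i| ]].

Definition R_dependent (Rd : nat) :=
  forall A B : set ('I_d -> R), ((Rd%:R)%:E < dist_max A B)%E ->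
    independent (birth_sigma A) (birth_sigma B).

End Random.
End Cubical.

(* Main.v *)
(** Everything is seen through the birth times.  For a function g on cubes, phi_n(g)
    denotes the persistent rank of the sublevel sets of g at levels s and t inside the
    cube [-n,n]^d, so that the persistent Betti number of X^n is phi_n of the birth times.
    Writing the rank as dim (Z + B) - dim B, with Z the cycles at level s and B the
    boundaries at level t, adding N cubes changes it by at most N, and it is additive over
    disjoint face-closed families of cubes.  Hence, cutting [-n,n]^d into translates of
    [-m,m]^d separated by corridors of width r+1, phi_n is a sum of k^d translates of phi_m
    up to an error of order n^d (1/m + m/n).

    By stationarity the normalized means satisfy |a_n - a_m| <= C (1/m + m/n), so they
    converge.  By r-dependence the block contributions are pairwise uncorrelated; with
    m = j^2 and n = j^4 the variance of phi_n / |Lambda^n| is O(1/j^2), which is summable and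
    gives almost sure convergence along n = j^4.  The bound
    |phi_n / |Lambda^n| - phi_N / |Lambda^N|| <= C (n - N) / n for N <= n fills the gaps. *)

Require Import Defs.
From HB Require Import structures.
From mathcomp Require Import all_boot all_order all_algebra.
From mathcomp Require Import all_classical all_reals all_analysis.
From mathcomp Require Import zify ring lra.
From mathcomp Require Import measurable_realfun lebesgue_measure lebesgue_integral probability.
Import Order.TTheory GRing.Theory Num.Theory numFieldNormedType.Exports.
Local Open Scope classical_set_scope.
Local Open Scope ring_scope.

Set Implicit Arguments. Unset Strict Implicit. Unset Printing Implicit Defensive.

(** * Rank of cycles modulo boundaries *)

Section RelativeRank.
Variables (F : fieldType) (T : choiceType) (bd : (T -> F) -> T -> F).

Definition supp_in (S : set T) (c : T -> F) := forall x, c x != 0 -> S x.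

Definition indep_mod (A B : set T) k :=
  exists z : 'I_k -> T -> F,
    (forall i, supp_in A (z i) /\ bd (z i) = (fun=> 0)) /\
    forall a : 'I_k -> F,
      (exists b, supp_in B b /\ (fun x => \sum_(i < k) a i * z i x) = bd b) ->
      forall i, a i = 0.

Definition rel_rank A B : nat :=
  xget 0%N [set k | indep_mod A B k /\ forall j, indep_mod A B j -> (j <= k)%N].

Lemma rel_rank_unique A B n :
  (forall k, indep_mod A B k <-> (k <= n)%N) -> rel_rank A B = n.
Proof.
move=> H; rewrite /rel_rank; case: xgetP => [m _ [/H mn Hm]|/(_ n)].
  by apply/eqP; rewrite eqn_leq mn Hm//; apply/H.
by case; split=> [|j /H]//; apply/H.
Qed.

(** Chains are transported by composition with [f] and [g]; since both commute with [bd], cycles,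
    boundaries and independence are preserved. Applied to shifts, this is translation invariance. *)
Lemma rel_rank_preimage (f g : T -> T) (A B : set T) :
  cancel f g -> cancel g f -> (forall c, bd (c \o f) = bd c \o f) ->
  rel_rank (f @^-1` A) (f @^-1` B) = rel_rank A B.
Proof.
move=> fK gK bdf.
have bdg c : bd (c \o g) = bd c \o g.
  have E : bd c = bd (c \o g) \o f.
    by rewrite -bdf; congr bd; apply/funext => x /=; rewrite fK.
  by rewrite E; apply/funext => x /=; rewrite gK.
have sf (S : set T) c : supp_in S c -> supp_in (f @^-1` S) (c \o f).
  by move=> h x /h.
have sg (S : set T) c : supp_in (f @^-1` S) c -> supp_in S (c \o g).
  by move=> h x /h; rewrite /= gK.
rewrite /rel_rank; congr (xget _ _).
suff E : forall k, indep_mod (f @^-1` A) (f @^-1` B) k = indep_mod A B k.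
  apply/seteqP; split=> k /= [h1 h2]; split.
  - by rewrite -E.
  - by move=> j; rewrite -E; exact: h2.
  - by rewrite E.
  - by move=> j; rewrite E; exact: h2.
move=> k; apply/propext; split=> -[z [zA zI]].
- exists (fun i => z i \o g); split=> [i|a [b [bB E]]].
    have [s1 s2] := zA i; split; first exact: sg.
    by rewrite bdg s2.
  apply: zI; exists (b \o f); split; first exact: sf.
  rewrite bdf -E; apply/funext => x /=.
  by apply: eq_bigr => i _; rewrite fK.
- exists (fun i => z i \o f); split=> [i|a [b [bB E]]].
    have [s1 s2] := zA i; split; first exact: sf.
    by rewrite bdf s2.
  apply: zI; exists (b \o g); split; first exact: sg.
  rewrite bdg -E; apply/funext => x /=.
  by apply: eq_bigr => i _; rewrite gK.
Qed.

Hypothesis bd_linear : forall a c c',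
  bd (fun x => a * c x + c' x) = (fun x => a * bd c x + bd c' x).

(** * Reduction to finite-dimensional linear algebra *)

Section FiniteModel.
Variables (C : finType) (iota : C -> T).
Hypothesis iota_inj : injective iota.
Hypothesis bd_closed : forall c,
  supp_in (range iota) c -> supp_in (range iota) (bd c).

Local Notation V := {ffun C -> F^o}.

Definition extend (v : V) : T -> F := fun x =>
  if [pick c | iota c == x] is Some c then v c else 0.

Definition restr (c : T -> F) : V := [ffun i => c (iota i)].

Lemma extendE v c : extend v (iota c) = v c.
Proof.
rewrite /extend; case: pickP => [c' /eqP/iota_inj->//|/(_ c)].
by rewrite eqxx.
Qed.

Lemma extend_supp v : supp_in (range iota) (extend v).
Proof.
move=> x; rewrite /extend; case: pickP => [c /eqP <- _|_]; first by exists c.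
by rewrite eqxx.
Qed.

Lemma extend_linear a u v :
  extend (a *: u + v) = (fun x => a * extend u x + extend v x).
Proof.
apply/funext => x; rewrite /extend; case: pickP => [c _|_].
  by rewrite !ffunE.
by rewrite mulr0 addr0.
Qed.

Lemma restrK c : supp_in (range iota) c -> extend (restr c) = c.
Proof.
move=> cs; apply/funext => x; rewrite /extend; case: pickP => [i /eqP <-|h].
  by rewrite ffunE.
apply/eqP; rewrite eq_sym; apply: contraT => /cs[i _ ix].
by move: (h i); rewrite ix eqxx.
Qed.

Lemma extendK v : restr (extend v) = v.
Proof. by apply/ffunP => c; rewrite ffunE extendE. Qed.

Definition dmap (v : V) : V := restr (bd (extend v)).

Lemma dmap_linear : linear dmap.
Proof.
move=> a u v; apply/ffunP => c.
by rewrite /dmap extend_linear bd_linear !ffunE.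
Qed.

HB.instance Definition _ := GRing.isLinear.Build F V V _ dmap dmap_linear.

Definition bdmap : 'End(V) := linfun dmap.

(** Since the range of [iota] is closed under [bd], the restriction in [dmap] loses no
    coefficient. *)
Lemma extend_bdmap v : extend (bdmap v) = bd (extend v).
Proof. by rewrite lfunE /= /dmap restrK//; apply/bd_closed/extend_supp. Qed.

Definition delta (c : C) : V := [ffun c' => (c == c')%:R].

Definition chains (S : set T) : {vspace V} :=
  (\sum_(c | iota c \in S) <[delta c]>)%VS.

Lemma mem_chains (S : set T) v :
  v \in chains S <-> forall c, v c != 0 -> S (iota c).
Proof.
split.
  move=> /memv_sumP[u uS ->] c; rewrite sum_ffunE => h.
  apply: contrapT => nS; move: h; rewrite big1 ?eqxx// => c' c'S.
  have /vlineP[k ->] := uS c' c'S.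
  rewrite !ffunE; case: eqVneq => [cc|]; last by rewrite scaler0.
  by case: nS; rewrite -cc; exact: set_mem.
move=> h; have -> : v = \sum_(c | iota c \in S) v c *: delta c.
  apply/ffunP => c; rewrite sum_ffunE.
  have [cS|cS] := boolP (iota c \in S).
    rewrite (bigD1 c)//= big1 ?addr0 => [|c' /andP[_ c'c]].
      by rewrite !ffunE eqxx [RHS]mulr1.
    by rewrite !ffunE (negbTE c'c) scaler0.
  rewrite big1 => [|c' c'S].
    by apply/eqP; apply: contraNT cS => /h; rewrite in_setE.
  rewrite !ffunE; case: eqVneq => [cc|]; last by rewrite scaler0.
  by rewrite cc (negbTE cS) in c'S.
by apply: memv_sumr => c _; apply: memvZ; exact: memv_line.
Qed.

Lemma mem_chainsE (S : set T) v : v \in chains S <-> supp_in S (extend v).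
Proof.
rewrite mem_chains; split=> h.
  move=> x; rewrite /extend; case: pickP => [c /eqP <-|_]; first exact: h.
  by rewrite eqxx.
by move=> c; rewrite -extendE; exact: h.
Qed.

Lemma dim_chains (S : set T) : (\dim (chains S) <= #|[pred c | iota c \in S]|)%N.
Proof.
rewrite -sum1_card; apply: leq_trans (dimv_leq_sum _ _ _) _.
by apply: leq_sum => c _; rewrite dim_vline; case: (_ == _).
Qed.

Lemma chainsS (A A' : set T) : A `<=` A' -> (chains A <= chains A')%VS.
Proof. by move=> AA'; apply/subvP => v /mem_chains h; apply/mem_chains => c /h/AA'. Qed.

Lemma chains_split (A A' : set T) : (chains A' <= chains A + chains (A' `\` A))%VS.
Proof.
apply/subv_sumP => c; rewrite in_setE => cA'.
have [cA|cA] := pselect (A (iota c)).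
  apply: subv_trans (addvSl _ _); apply: (sumv_sup c) => //.
  by rewrite in_setE.
apply: subv_trans (addvSr _ _); apply: (sumv_sup c) => //.
by rewrite in_setE.
Qed.

Definition cycles (A : set T) : {vspace V} := (chains A :&: lker bdmap)%VS.
Definition bounds (B : set T) : {vspace V} := (bdmap @: chains B)%VS.

Lemma mem_bounds (B : set T) v :
  v \in bounds B <-> exists b, supp_in B b /\ supp_in (range iota) b /\ extend v = bd b.
Proof.
split.
  move=> /memv_imgP[u /mem_chainsE uB ->]; exists (extend u).
  by rewrite extend_bdmap; split=> //; split=> //; exact: extend_supp.
move=> [b [bB [br E]]]; apply/memv_imgP; exists (restr b).
  by apply/mem_chainsE; rewrite restrK.
by rewrite -[v]extendK E -[b in LHS]restrK// -extend_bdmap extendK.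
Qed.

(** This is the dimension of (Z + B) / B. The boundaries need not lie among the cycles over [A],
    hence the sum; the subtraction is never truncated. *)
Definition brank A B : nat := (\dim (cycles A + bounds B) - \dim (bounds B))%N.

Lemma brankE A B : brank A B = \dim (cycles A :\: bounds B).
Proof.
have h1 := dimv_sum_cap (cycles A) (bounds B).
have h2 := dimv_cap_compl (cycles A) (bounds B).
by rewrite /brank; move: h1 h2; move: (\dim _) (\dim _) (\dim _) (\dim _) (\dim _); lia.
Qed.

Lemma extend_sum k (a : 'I_k -> F) (z : 'I_k -> V) :
  extend (\sum_i a i *: z i) = (fun x => \sum_i a i * extend (z i) x).
Proof.
apply/funext => x; rewrite /extend; case: pickP => [c _|_].
  by rewrite sum_ffunE; apply: eq_bigr => i _; rewrite ffunE.
by rewrite big1// => i _; rewrite mulr0.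
Qed.

(** A basis of a complement of the boundaries in the cycles provides independent classes.
    Conversely, [k] independent classes span a space of dimension [k] that meets the boundaries
    trivially, so its sum with them is direct. *)
Lemma rel_rank_brank A B : A `<=` range iota -> B `<=` range iota ->
  rel_rank A B = brank A B.
Proof.
move=> Ar Br; apply: rel_rank_unique => k; split; last first.
  rewrite brankE => kn; set W := (_ :\: _)%VS in kn.
  pose z (i : 'I_k) : V := (vbasis W)`_i.
  have zW i : z i \in W by apply/vbasis_mem/mem_nth; rewrite size_tuple (leq_trans (ltn_ord i)).
  exists (fun i => extend (z i)); split=> [i|a [b [bB E]]].
    have : z i \in cycles A by apply: subvP (zW i); exact: diffvSl.
    rewrite memv_cap => /andP[/mem_chainsE ? ]; rewrite memv_ker => /eqP Dz.
    split=> //; rewrite -extend_bdmap Dz.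
    by apply/funext => x; rewrite /extend; case: pickP => // c; rewrite ffunE.
  have : \sum_i a i *: z i \in (bounds B :&: W)%VS.
    rewrite memv_cap; apply/andP; split; last first.
      by apply: memv_suml => i _; exact: memvZ.
    apply/mem_bounds; exists b; rewrite extend_sum; split=> //; split=> //.
    by move=> x /bB/Br.
  rewrite capvC capv_diff memv0 => /eqP E0.
  have /freeP fr := basis_free (vbasisP W).
  (* Padding the [k] coefficients by zeros lets freeness of the whole basis apply to its first [k]
     vectors. *)
  pose a' (j : nat) := if insub j is Some j' then a j' else 0.
  have a'E (i : 'I_k) : a' i = a i by rewrite /a' valK.
  have S0 : \sum_(i < \dim W) a' i *: (vbasis W)`_i = 0.
    rewrite -[RHS]E0 [RHS](eq_bigr (fun i : 'I_k => a' i *: (vbasis W)`_i)).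
      rewrite (big_ord_widen _ (fun i => a' i *: (vbasis W)`_i) kn) [RHS]big_mkcond.
      apply: eq_bigr => i _; case: ltnP => // ki.
      by rewrite /a' insubN ?scale0r// -leqNgt.
    by move=> i _; rewrite a'E.
  by move=> i; rewrite -a'E; exact: (fr _ S0 (widen_ord kn i)).
move=> [z [zA zI]].
pose v i := restr (z i).
have zr i : extend (v i) = z i.
  by rewrite restrK// => x; case: (zA i) => + _ => /[apply]/Ar.
have vZ i : v i \in cycles A.
  rewrite memv_cap memv_ker; apply/andP; split.
    by apply/mem_chainsE; rewrite zr; case: (zA i).
  rewrite -[bdmap _]extendK extend_bdmap zr; case: (zA i) => _ ->.
  by apply/eqP/ffunP => c; rewrite !ffunE.
have vI (a : 'I_k -> F) : \sum_i a i *: v i \in bounds B -> forall i, a i = 0.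
  move=> /mem_bounds[b [bB [_ E]]]; apply: zI; exists b; split=> //.
  rewrite -E extend_sum; apply/funext => x.
  by apply: eq_bigr => i _; rewrite zr.
pose X := [tuple v i | i < k].
have XE i : X`_(i : 'I_k) = v i by rewrite -tnth_nth tnth_mktuple.
have frX : free X.
  apply/freeP => a a0; apply: vI; rewrite [X in X \in _](_ : _ = 0) ?mem0v//.
  by rewrite -[RHS]a0; apply: eq_bigr => i _; rewrite XE.
have dX : \dim <<X>>%VS = k by have /eqP := frX; rewrite size_tuple.
have XB : (<<X>> :&: bounds B)%VS = 0%VS.
  apply/eqP; rewrite -subv0; apply/subvP => u.
  rewrite memv_cap => /andP[uX uB]; rewrite memv0.
  rewrite (coord_span uX) big1// => i _.
  rewrite (vI (fun i => coord X i u)) ?scale0r//.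
  suff -> : \sum_i coord X i u *: v i = u by [].
  by rewrite [RHS](coord_span uX); apply: eq_bigr => j _; rewrite XE.
have XS : (<<X>> <= cycles A)%VS.
  by apply/span_subvP => u /tnthP[i ->]; rewrite tnth_mktuple.
rewrite /brank -[in leqLHS]dX -(addnK (\dim (bounds B)) (\dim <<X>>%VS)).
by apply: leq_sub2r; rewrite -dimv_disjoint_sum//; apply/dimvS/addvS.
Qed.

(** * Effect of additional cells on the rank *)

Section Gap.
Variables (A A' B B' : set T) (G : pred C).
Hypotheses (AA' : A `<=` A') (BB' : B `<=` B').
Hypothesis AG : forall c, A' (iota c) -> ~ A (iota c) -> G c.
Hypothesis BG : forall c, B' (iota c) -> ~ B (iota c) -> G c.

Let dim_gap (E E' : set T) : 
  (forall c, E' (iota c) -> ~ E (iota c) -> G c) ->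
  (\dim (chains (E' `\` E)) <= #|G|)%N.
Proof.
move=> EG; apply: leq_trans (dim_chains _) _; apply: subset_leq_card.
by apply/fintype.subsetP => c; rewrite !inE => -[]; exact: EG.
Qed.

Let dim_bounds_gap : (\dim (bounds B') <= \dim (bounds B) + #|G|)%N.
Proof.
apply: leq_trans (dimvS (limgS bdmap (chains_split B B'))) _.
rewrite limgD; apply: leq_trans (dimv_add_leqif _ _) _.
rewrite leq_add2l; apply: leq_trans (dim_gap BG).
by rewrite -(limg_ker_dim bdmap (chains (B' `\` B))) leq_addl.
Qed.

Let dim_cycles_gap : (\dim (cycles A') <= \dim (cycles A) + #|G|)%N.
Proof.
have h := dimv_sum_cap (cycles A') (chains A).
(* The cycles over [A] are cut out of those over [A'] by the chains of [A], whose codimension in the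
   chains of [A'] is at most [#|G|]. *)
have -> : \dim (cycles A) = \dim (cycles A' :&: chains A).
  congr (\dim _); rewrite /cycles -capvA [(lker bdmap :&: _)%VS]capvC capvA; congr (_ :&: _)%VS.
  by rewrite capvC; apply/esym/capv_idPl/chainsS.
have h1 : (\dim (cycles A' + chains A) <= \dim (chains A) + #|G|)%N.
  apply: (@leq_trans (\dim (chains A + chains (A' `\` A)))).
    apply: dimvS; rewrite subv_add addvSl andbT.
    exact: subv_trans (capvSl _ _) (chains_split _ _).
  apply: leq_trans (dimv_add_leqif _ _) _.
  by rewrite leq_add2l; exact: dim_gap.
by move: h h1; move: (\dim _) (\dim _) (\dim _) (\dim _) #|_|; lia.
Qed.

Let boundsS : (bounds B <= bounds B')%VS.
Proof. exact/limgS/chainsS. Qed.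

Let cyclesS : (cycles A <= cycles A')%VS.
Proof. by apply: capvS => //; exact/chainsS. Qed.

Hypotheses (A'r : A' `<=` range iota) (B'r : B' `<=` range iota).

(** In dim (Z + B) - dim B the first term is monotone, so only the growth of the boundaries can cost
    anything. *)
Lemma rel_rank_gap_ge : (rel_rank A B <= rel_rank A' B' + #|G|)%N.
Proof.
rewrite !rel_rank_brank//; [|exact: subset_trans A'r|exact: subset_trans B'r].
have h := dim_bounds_gap.
have h1 : (\dim (cycles A + bounds B) <= \dim (cycles A' + bounds B'))%N.
  by apply/dimvS/addvS.
have h2 : (\dim (bounds B') <= \dim (cycles A' + bounds B'))%N by apply/dimvS/addvSr.
by rewrite /brank; move: h h1 h2; move: (\dim _) (\dim _) (\dim _) (\dim _) #|_|; lia.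
Qed.

(** Here the rank is read as dim Z - dim (Z ∩ B): the intersection is monotone, so only the growth
    of the cycles matters. Using one form of the rank per direction gives the loss [#|G|] rather
    than twice that. *)
Lemma rel_rank_gap_le : (rel_rank A' B' <= rel_rank A B + #|G|)%N.
Proof.
rewrite !rel_rank_brank//; [|exact: subset_trans A'r|exact: subset_trans B'r].
have h := dim_cycles_gap.
have h1 := dimv_sum_cap (cycles A) (bounds B).
have h2 := dimv_sum_cap (cycles A') (bounds B').
have h3 : (\dim (cycles A :&: bounds B) <= \dim (cycles A' :&: bounds B'))%N.
  by apply/dimvS/capvS.
rewrite /brank; move: h h1 h2 h3.
move: (\dim _) (\dim _) (\dim _) (\dim _) (\dim _) (\dim _) (\dim _) (\dim _) #|_|; lia.
Qed.

End Gap.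

Lemma rel_rank_leq_card (A B : set T) : A `<=` range iota -> B `<=` range iota ->
  (rel_rank A B <= #|C|)%N.
Proof.
move=> Ar Br; rewrite rel_rank_brank// brankE.
apply: leq_trans (dimvS (diffvSl _ _)) _; apply: leq_trans (dimvS (capvSl _ _)) _.
by apply: leq_trans (dim_chains _) _; exact: max_card.
Qed.

(** * Additivity over disjoint closed families *)

Section DisjointPieces.
Variables (I : finType) (U : I -> set T).
Hypothesis Udisj : forall i j x, U i x -> U j x -> i = j.
Hypothesis Uclosed : forall i c, supp_in (U i) c -> supp_in (U i) (bd c).

Let dim_sum_pieces (W : I -> {vspace V}) : (forall i, W i <= chains (U i))%VS ->
  \dim (\sum_i W i) = (\sum_i \dim (W i))%N.
Proof.
move=> WU; suff /directvP/= : directv (\sum_i W i) by [].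
apply/directv_sum_independent => us usW S0 i _; apply/ffunP => c.
have usU j c' : us j c' != 0 -> U j (iota c').
  by move: c'; apply/mem_chains; apply: subvP (usW j _).
have := congr1 (fun v : V => v c) S0; rewrite sum_ffunE (bigD1 i)//= !ffunE.
have [//|usc] := eqVneq (us i c) 0.
rewrite big1 ?addr0// => j ji; apply/eqP; apply: contraNT ji => /usU Uj.
by rewrite (Udisj Uj (usU _ _ usc)).
Qed.

Variables A B : set T.
Hypotheses (AU : A `<=` \bigcup_i U i) (BU : B `<=` \bigcup_i U i).
Hypotheses (Ar : A `<=` range iota) (Br : B `<=` range iota).

Let cut i (v : V) : V := [ffun c => if `[< U i (iota c) >] then v c else 0].

Let cut_chains i (S : set T) v : v \in chains S -> cut i v \in chains (S `&` U i).
Proof.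
move=> /mem_chains vS; apply/mem_chains => c; rewrite ffunE.
by case: asboolP => [? /vS|]; rewrite ?eqxx.
Qed.

Let cut_sum (S : set T) v : S `<=` \bigcup_i U i -> v \in chains S ->
  v = \sum_i cut i v.
Proof.
move=> SU /mem_chains vS; apply/ffunP => c; rewrite sum_ffunE.
have [v0|/vS/SU[i _ Ui]] := eqVneq (v c) 0.
  by rewrite v0 big1// => i _; rewrite ffunE v0 if_same.
rewrite (bigD1 i)//= big1 ?addr0 => [|j ji]; rewrite ffunE; case: asboolP => //.
by move=> /Udisj/(_ Ui)/eqP; rewrite (negbTE ji).
Qed.

Let bdmap_chains i v : v \in chains (U i) -> bdmap v \in chains (U i).
Proof. by move=> /mem_chainsE vU; apply/mem_chainsE; rewrite extend_bdmap; exact: Uclosed. Qed.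

Let chains_piece i S : (chains (S `&` U i) <= chains (U i))%VS.
Proof. by apply: chainsS => x []. Qed.

Let bounds_piece i : (bounds (B `&` U i) <= chains (U i))%VS.
Proof.
apply/subvP => _ /memv_imgP[u uB ->]; apply: bdmap_chains.
exact: subvP (chains_piece _ _) _ uB.
Qed.

Let cycles_piece i : (cycles (A `&` U i) <= chains (U i))%VS.
Proof. exact: subv_trans (capvSl _ _) (chains_piece _ _). Qed.

Let bounds_sum : bounds B = (\sum_i bounds (B `&` U i))%VS.
Proof.
apply: subv_anti; apply/andP; split; last first.
  by apply/subv_sumP => i _; apply/limgS/chainsS; exact: subIsetl.
rewrite /bounds -limg_sum; apply: limgS; apply/subvP => v vB.
rewrite (cut_sum BU vB); apply: memv_sumr => i _; exact: cut_chains.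
Qed.

(** Each piece of a cycle is itself a cycle: the boundaries of the pieces have disjoint supports, as
    every [U i] is closed under [bd], and they add up to zero. *)
Let cycles_sum : cycles A = (\sum_i cycles (A `&` U i))%VS.
Proof.
apply: subv_anti; apply/andP; split; last first.
  by apply/subv_sumP => i _; apply: capvS => //; apply: chainsS; exact: subIsetl.
apply/subvP => v; rewrite memv_cap memv_ker => /andP[vA /eqP Dv].
rewrite (cut_sum AU vA); apply: memv_sumr => i _.
rewrite memv_cap memv_ker cut_chains//=; apply/eqP/ffunP => c; rewrite [RHS]ffunE.
have bdU j c' : bdmap (cut j v) c' != 0 -> U j (iota c').
  move: c'; apply/mem_chains/bdmap_chains; exact: subvP (chains_piece _ _) _ (cut_chains _ vA).
have : bdmap (\sum_j cut j v) c = 0 by rewrite -(cut_sum AU vA) Dv ffunE.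
rewrite linear_sum sum_ffunE (bigD1 i)//=.
have [//|nz] := eqVneq (bdmap (cut i v) c) 0.
rewrite big1 ?addr0// => j ji; apply/eqP; apply: contraNT ji => /bdU Uj.
by rewrite (Udisj Uj (bdU _ _ nz)).
Qed.

Lemma rel_rank_disjoint :
  rel_rank A B = (\sum_i rel_rank (A `&` U i) (B `&` U i))%N.
Proof.
rewrite rel_rank_brank// (eq_bigr (fun i => brank (A `&` U i) (B `&` U i))); last first.
  by move=> i _; apply: rel_rank_brank => x [] => [/Ar|/Br].
rewrite /brank sumnB => [|i _]; last by apply/dimvS/addvSr.
congr (_ - _)%N; last by rewrite bounds_sum dim_sum_pieces.
rewrite bounds_sum cycles_sum -big_split/= dim_sum_pieces// => i.
by rewrite subv_add cycles_piece bounds_piece.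
Qed.

End DisjointPieces.
End FiniteModel.
End RelativeRank.

(** * Elementary cubes and blocks *)

Section CubeGeometry.
Variables (R : realType) (d : nat).
Local Notation cube := (cube d).
Local Notation shift := (@Defs.shift d).

Definition box_cubes (lo hi : 'I_d -> int) : set cube :=
  [set Q : cube | forall i, lo i <= Q.1 i /\ Q.1 i + (Q.2 i)%:Z <= hi i].

Definition real_box (lo hi : 'I_d -> int) : set ('I_d -> R) :=
  [set x | forall i, (lo i)%:~R <= x i /\ x i <= (hi i)%:~R].

(** Inclusion in the box is tested on the lowest and the highest vertex of the cube. *)
Lemma cube_set_real_box lo hi (Q : cube) :
  cube_set Q `<=` real_box lo hi <-> box_cubes lo hi Q.
Proof.
split=> [h i|h x xQ i].
  have lowc : cube_set Q (fun j => (Q.1 j)%:~R : R).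
    by move=> j; case: (Q.2 j) => //; split=> //; rewrite lerDl.
  have uppc : cube_set Q (fun j => (Q.1 j + (Q.2 j)%:Z)%:~R : R).
    move=> j; rewrite intrD; case: (Q.2 j) => /=; last by rewrite addr0.
    by split=> //; rewrite lerDl.
  have [h1 _] := h _ lowc i; have [_ h2] := h _ uppc i.
  by move: h1 h2; rewrite !ler_int.
have [h1 h2] := h i; move: (xQ i) h2; rewrite -!(ler_int R) intrD in h1 *.
case: (Q.2 i) => /= [[x1 x2] h2|-> h2]; split=> //; last by rewrite addr0 in h2.
- exact: le_trans x1.
- exact: le_trans h2.
Qed.

Local Notation cst n := (fun=> n : int).

Lemma LambdaE n : @Lambda R d n = real_box (cst (- n%:Z)) (cst n%:Z).
Proof. by apply/seteqP; split=> x h i; have := h i; rewrite /= mulrNz. Qed.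

Lemma bdry_linear a (c c' : cube -> R) :
  bdry (fun x => a * c x + c' x) = (fun x => a * bdry c x + bdry c' x).
Proof.
apply/funext => Q; rewrite /bdry mulr_sumr -big_split/=; apply: eq_bigr => i _.
ring.
Qed.

Lemma bdry_shift (z : 'I_d -> int) (c : cube -> R) :
  bdry (c \o shift z) = bdry c \o shift z.
Proof.
apply/funext => Q; rewrite /bdry /=; apply: eq_bigr => i _.
congr (_ * (c _ - c _)); rewrite /Defs.shift /coface_hi /coface_lo /=; congr pair.
by apply/ffunP => j; rewrite !ffunE; case: eqP => // _; rewrite addrAC.
Qed.

Lemma shiftK z : cancel (shift z) (shift (fun i => - z i)).
Proof. by case=> l e; congr pair; apply/ffunP => i; rewrite !ffunE addrK. Qed.

Lemma shiftNK z : cancel (shift (fun i => - z i)) (shift z).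
Proof. by case=> l e; congr pair; apply/ffunP => i; rewrite !ffunE subrK. Qed.

(** A coface of a cube outside the box also leaves the box, so every term of the boundary
    coefficient at such a cube vanishes. *)
Lemma box_cubes_bdry lo hi (c : cube -> R) :
  supp_in (box_cubes lo hi) c -> supp_in (box_cubes lo hi) (bdry c).
Proof.
move=> cS Q; apply: contraNP => nQ; rewrite /bdry big1// => i Qi.
suff [-> ->] : c (coface_hi i Q) = 0 /\ c (coface_lo i Q) = 0 by rewrite subrr mulr0.
split; apply/eqP; apply: contraPT nQ => /cS h nQ'; apply: nQ' => j.
- have := h j; rewrite /= !ffunE; case: eqP => [->|//]; rewrite (negbTE Qi) /=; lia.
- have := h j; rewrite /= !ffunE; case: eqP => [->|//]; rewrite (negbTE Qi) /=; lia.
Qed.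

(** The interval [-n, n] contains 2n + 1 integer points and 2n unit intervals, hence 4n + 1
    elementary intervals per coordinate. *)
Definition box_code n := {ffun 'I_d -> 'I_(4 * n + 1)}.

(* An elementary interval in [-n, n] is coded by twice its midpoint, shifted to start at 0. *)
Definition decode_cube n (c : box_code n) : cube :=
  ([ffun i => (c i)./2%:Z - n%:Z], [ffun i => odd (c i)]).

Local Notation sym_box n := (box_cubes (cst (- n%:Z)) (cst n%:Z)).

Lemma decode_inj n : injective (@decode_cube n).
Proof.
move=> c c' [/ffunP h1 /ffunP h2]; apply/ffunP => i; apply: val_inj => /=.
have := h1 i; have := h2 i; rewrite !ffunE => h3 h4.
by rewrite -(odd_double_half (c i)) -(odd_double_half (c' i)) h3; congr (_ + _.*2)%N; lia.
Qed.

Lemma range_decode n : range (@decode_cube n) = sym_box n.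
Proof.
apply/seteqP; split=> [_ [c _ <-] i|Q QB].
  by rewrite /= !ffunE; have := ltn_ord (c i); have := odd_double_half (c i); lia.
have h i : (`|(Q.1 i + n%:Z)%R|.*2 + Q.2 i < 4 * n + 1)%N.
  by have := QB i; case: (Q.2 i); lia.
exists [ffun i => Ordinal (h i)] => //.
rewrite /decode_cube [RHS]surjective_pairing; congr pair; apply/ffunP => i; rewrite !ffunE /=.
  have := QB i; rewrite halfD odd_double /= doubleK; case: (Q.2 i) => /=; lia.
by rewrite oddD odd_double; case: (Q.2 i).
Qed.

(** Right continuity makes the infimum attained: a cube with birth time at most [u] lies in [X v]
    for every v > u, hence in their intersection [X u]. *)
Lemma birth_le X (u : R) (Q : cube) : cubical_filtration X -> 0 <= u ->
  (birth X Q <= u%:E)%E <-> cube_set Q `<=` X u.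
Proof.
move=> [_ Xmono Xcap] u0; split=> [bu|QX]; last first.
  by apply: ereal_inf_lbound; exists u.
rewrite Xcap// => x xQ v /= uv.
have /ereal_inf_lt[_ [t [t0 Qt] <-]] : (birth X Q < v%:E)%E by apply: le_lt_trans bu _; rewrite lte_fin.
by rewrite lte_fin => /ltW tv; apply: (Xmono t v) => //; exact: Qt.
Qed.

(** * Persistent rank in a box as a functional of birth times *)

Section PersistentRank.
Variables (q : nat) (s t : R).

Definition born_by k u (g : cube -> \bar R) : set cube :=
  [set Q : cube | cdim Q = k /\ (g Q <= u%:E)%E].

(** Letting [g] be any function on cubes makes this a functional on the space where stationarity is
    stated, and turns translation into composition with [shift]. *)
Definition box_rank n g : nat :=
  rel_rank (@bdry R d) (born_by q s g `&` sym_box n) (born_by q.+1 t g `&` sym_box n).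

Lemma pbetti_box_rank X n : cubical_filtration X -> 0 <= s -> s <= t ->
  pbetti q (restrictX X n) s t = box_rank n (birth X).
Proof.
move=> XF s0 st; have t0 := le_trans s0 st.
have E k u : 0 <= u -> born_by k u (birth X) `&` sym_box n =
    [set Q | cdim Q = k /\ cube_set Q `<=` restrictX X n u].
  move=> u0; apply/seteqP; split=> Q /=.
    move=> [[<- /(birth_le _ XF u0) QX] /cube_set_real_box]; rewrite -LambdaE => QL.
    by split=> // x xQ; split; [exact: QX|exact: QL].
  move=> [<- h]; split; first by split=> //; apply/birth_le => // x /h[].
  by apply/cube_set_real_box; rewrite -LambdaE => x /h[].
by rewrite /box_rank !E.
Qed.

Let born_sub k u g n W : W `<=` sym_box n ->
  born_by k u g `&` W `<=` range (@decode_cube n).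
Proof. by move=> Ws; rewrite range_decode => Q [_ /Ws]. Qed.

Let closed n (c : cube -> R) :
  supp_in (range (@decode_cube n)) c -> supp_in (range (@decode_cube n)) (bdry c).
Proof. by rewrite range_decode; exact: box_cubes_bdry. Qed.

Lemma box_rank_le n g : (box_rank n g <= (4 * n + 1) ^ d)%N.
Proof.
have -> : ((4 * n + 1) ^ d)%N = #|box_code n| by rewrite card_ffun !card_ord.
by apply: (rel_rank_leq_card bdry_linear (@decode_inj n) (@closed n)); exact: born_sub.
Qed.

Lemma box_rank_shift n g (z : 'I_d -> int) :
  box_rank n (g \o shift z) =
  let W := box_cubes (fun i => z i - n%:Z) (fun i => z i + n%:Z) in
  rel_rank (@bdry R d) (born_by q s g `&` W) (born_by q.+1 t g `&` W).
Proof.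
rewrite /= -(rel_rank_preimage _ _ (shiftK z) (shiftNK z) (bdry_shift z)).
congr rel_rank; apply/seteqP; split=> Q [Q1 Q2]; split=> // i; have := Q2 i;
  rewrite /= !ffunE; lia.
Qed.

Section Gap.
Variables (n h : nat) (W : set cube) (good : pred 'I_(4 * n + 1)).
Hypothesis Wn : W `<=` sym_box n.
Hypothesis goodW : forall c : box_code n, (forall i, good (c i)) -> W (decode_cube c).
Hypothesis hgood : (h <= #|good|)%N.

(** Codes with some coordinate outside [good]; every cube of the box missed by [W] has its code
    here, and at least [h ^ d] codes are not here. *)
Let gap : pred (box_code n) := [pred c : box_code n | ~~ [forall i, good (c i)]].

Let card_gap : (#|gap| <= (4 * n + 1) ^ d - h ^ d)%N.
Proof.
have : (#|[pred c : box_code n | [forall i, good (c i)]]| + #|gap| = (4 * n + 1) ^ d)%N.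
  have -> : ((4 * n + 1) ^ d)%N = #|box_code n| by rewrite card_ffun !card_ord.
  by rewrite -(cardC [pred c : box_code n | [forall i, good (c i)]]).
have -> : #|[pred c : box_code n | [forall i, good (c i)]]| = (#|good| ^ d)%N.
  by rewrite -[in RHS](card_ord d) -card_ffun_on; apply: eq_card => c; rewrite inE.
have : (h ^ d <= #|good| ^ d)%N by case: (d) => // d'; rewrite leq_exp2r.
lia.
Qed.

Let gapP c k u g : (born_by k u g `&` sym_box n) (decode_cube c) ->
  ~ (born_by k u g `&` W) (decode_cube c) -> gap c.
Proof.
by move=> [b _] nW; apply/negP => /forallP ?; apply: nW; split=> //; exact: goodW.
Qed.

Let sub k u g : born_by k u g `&` W `<=` born_by k u g `&` sym_box n.
Proof. exact: setIS. Qed.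

Lemma box_rank_gap_le g : (box_rank n g <=
  rel_rank (@bdry R d) (born_by q s g `&` W) (born_by q.+1 t g `&` W) +
  ((4 * n + 1) ^ d - h ^ d))%N.
Proof.
apply: leq_trans (leq_add (leqnn _) card_gap).
by apply: (rel_rank_gap_le bdry_linear (@decode_inj n) (@closed n));
  [exact: sub|exact: sub|move=> c; exact: gapP|move=> c; exact: gapP|exact: born_sub|exact: born_sub].
Qed.

Lemma box_rank_gap_ge g :
  (rel_rank (@bdry R d) (born_by q s g `&` W) (born_by q.+1 t g `&` W) <=
  box_rank n g + ((4 * n + 1) ^ d - h ^ d))%N.
Proof.
apply: leq_trans (leq_add (leqnn _) card_gap).
by apply: (rel_rank_gap_ge bdry_linear (@decode_inj n) (@closed n));
  [exact: sub|exact: sub|move=> c; exact: gapP|move=> c; exact: gapP|exact: born_sub|exact: born_sub].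
Qed.

End Gap.

Lemma box_rank_subbox N n g : (N <= n)%N ->
  (box_rank n g <= box_rank N g + ((4 * n + 1) ^ d - (4 * N + 1) ^ d))%N /\
  (box_rank N g <= box_rank n g + ((4 * n + 1) ^ d - (4 * N + 1) ^ d))%N.
Proof.
(* Codes are 2 (midpoint + n), so the elementary intervals in [-N, N] have the codes from 2 (n - N)
   to 2 (n + N). *)
move=> Nn; pose good := [pred e : 'I_(4 * n + 1) | (2 * (n - N) <= e <= 2 * (n - N) + 4 * N)%N].
have Wn : sym_box N `<=` sym_box n by move=> Q h i; have := h i; lia.
have goodW (c : box_code n) : (forall i, good (c i)) -> sym_box N (decode_cube c).
  by move=> h i; have := h i; have := odd_double_half (c i); rewrite /= !ffunE; lia.
have hgood : (4 * N + 1 <= #|good|)%N.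
  have lt (r : 'I_(4 * N + 1)) : (2 * (n - N) + r < 4 * n + 1)%N by have := ltn_ord r; lia.
  rewrite -[leqLHS]card_ord -(@card_imset _ _ (fun r => Ordinal (lt r))) => [|r r' [] /addnI/val_inj//].
  apply/subset_leq_card/fintype.subsetP => _ /imsetP[r _ ->].
  by rewrite inE /=; have := ltn_ord r; lia.
by split; [exact: (box_rank_gap_le Wn goodW hgood)|exact: (box_rank_gap_ge Wn goodW hgood)].
Qed.

(** * Decomposition of a box into separated blocks *)

Section Blocks.
Variables (m n L k : nat).
Hypotheses (mL : (2 * m < L)%N) (kL : (k * L <= 2 * n)%N).

(** The block of index [z] has lower corner [z i * L - n]: blocks start at -n, repeat with period
    [L], and neighbours are separated by corridors of width L - 2m > 0. *)
Definition block_center (z : {ffun 'I_d -> 'I_k}) (i : 'I_d) : int :=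
  (z i * L + m)%N%:Z - n%:Z.

Let U (z : {ffun 'I_d -> 'I_k}) : set cube :=
  box_cubes (fun i => block_center z i - m%:Z) (fun i => block_center z i + m%:Z).

Let mulL (j : 'I_k) : ((j * L + L)%N <= 2 * n)%N.
Proof. by rewrite -mulSnr; apply: leq_trans kL; rewrite leq_mul2r ltn_ord orbT. Qed.

Let Un : \bigcup_z U z `<=` sym_box n.
Proof.
move=> Q [z _ Uz] i; have := Uz i; rewrite /block_center; have := mulL (z i); lia.
Qed.

Let Udisj z z' Q : U z Q -> U z' Q -> z = z'.
Proof.
move=> h h'; apply/ffunP => i; apply: val_inj => /=.
have := h i; have := h' i; rewrite /block_center.
have [] := ltngtP (z i) (z' i) => // lt; have := lt; rewrite -(leq_pmul2r (m := L)) ?mulSnr; lia.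
Qed.

(** Codes of the elementary intervals inside one of the [k] one-dimensional blocks, with 4m + 1
    codes per block. *)
Let good := [pred e : 'I_(4 * n + 1) | [exists j : 'I_k, (2 * (j * L) <= e <= 2 * (j * L) + 4 * m)%N]].

Let goodU (c : box_code n) : (forall i, good (c i)) -> (\bigcup_z U z) (decode_cube c).
Proof.
move=> h; have /fin_all_exists[j jP] i : exists j : 'I_k,
    (2 * (j * L) <= c i <= 2 * (j * L) + 4 * m)%N by apply/existsP; exact: h.
exists [ffun i => j i] => // i; rewrite /block_center /= !ffunE.
have := jP i; have := odd_double_half (c i).
move: (nat_of_ord (j i) * L)%N (nat_of_ord (c i)) => J e; lia.
Qed.

Let card_good : (k * (4 * m + 1) <= #|good|)%N.
Proof.
have lt (p : 'I_k * 'I_(4 * m + 1)) : (2 * (p.1 * L) + p.2 < 4 * n + 1)%N.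
  by have := mulL p.1; have := ltn_ord p.2; lia.
have -> : (k * (4 * m + 1))%N = #|{: 'I_k * 'I_(4 * m + 1)}| by rewrite card_prod !card_ord.
rewrite -(@card_imset _ _ (fun p => Ordinal (lt p))); last first.
  move=> [j r] [j' r'] [/= E]; suff jj : j = j' by subst j'; congr pair; apply: val_inj => /=; lia.
  apply: val_inj => /=; have := ltn_ord r; have := ltn_ord r'.
  have [] := ltngtP j j' => // lt'; have := lt'; rewrite -(leq_pmul2r (m := L)) ?mulSnr; lia.
apply/subset_leq_card/fintype.subsetP => _ /imsetP[p _ ->]; rewrite inE.
by apply/existsP; exists p.1; rewrite /= leq_addr leq_add2l -ltnS -[ltnRHS]addn1 ltn_ord.
Qed.

(** The rank over the union of the blocks is the intermediate quantity: it equals the sum exactly,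
    since blocks are disjoint and closed under faces, and it differs from the rank of the box by at
    most the number of remaining cubes. *)
Lemma box_rank_blocks g (S := (\sum_z box_rank m (g \o shift (block_center z)))%N) :
  (box_rank n g <= S + ((4 * n + 1) ^ d - (k * (4 * m + 1)) ^ d))%N /\
  (S <= box_rank n g + ((4 * n + 1) ^ d - (k * (4 * m + 1)) ^ d))%N.
Proof.
suff -> : S = rel_rank (@bdry R d) (born_by q s g `&` \bigcup_z U z)
                         (born_by q.+1 t g `&` \bigcup_z U z).
  by split; [exact: (box_rank_gap_le Un goodU card_good)|exact: (box_rank_gap_ge Un goodU card_good)].
rewrite (rel_rank_disjoint bdry_linear (@decode_inj n) (@closed n) Udisj) => [||Q []//|Q []//||].
- apply: eq_bigr => z _; rewrite box_rank_shift /=.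
  have E (S' : set cube) : S' `&` \bigcup_z U z `&` U z = S' `&` U z.
    by rewrite -setIA; congr (_ `&` _); apply/setIidPr => Q; exists z.
  by rewrite !E.
- by move=> z c; exact: box_cubes_bdry.
- exact: born_sub.
- exact: born_sub.
Qed.

End Blocks.

(** The rank depends only on which of the finitely many cubes of the box are born by [s] and by [t].
    All measurability statements are derived from this finite description. *)
Lemma box_rank_config n : exists psi : {set box_code n} -> {set box_code n} -> nat,
  forall g, box_rank n g = psi [set c | (g (decode_cube c) <= s%:E)%E]%SET
    [set c | (g (decode_cube c) <= t%:E)%E]%SET.
Proof.
pose sel k (S : {set box_code n}) := [set Q : cube | cdim Q = k /\ exists2 c, c \in S & Q = decode_cube c].
exists (fun S S' => rel_rank (@bdry R d) (sel q S) (sel q.+1 S')) => g.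
rewrite /box_rank -range_decode; congr rel_rank; apply/seteqP; split=> Q /=.
- by move=> [[<- gQ] [c _ cQ]]; split=> //; exists c; rewrite ?inE ?cQ.
- by move=> [<- [c]]; rewrite finset.in_set => gQ ->; split=> //; exists c.
- by move=> [[<- gQ] [c _ cQ]]; split=> //; exists c; rewrite ?inE ?cQ.
- by move=> [<- [c]]; rewrite finset.in_set => gQ ->; split=> //; exists c.
Qed.

End PersistentRank.
End CubeGeometry.

(** * Counting estimates and limits of sequences *)

Section Estimates.
Variable R : realType.
Implicit Types x y : R.

(** Bernoulli's inequality for the ratio y / x, multiplied by [x ^+ d]; its induction step leaves
    the remainder k (1 - y / x)^2. *)
Lemma subrX_le d x y : 0 < x -> 0 <= y ->
  x ^+ d - y ^+ d <= d%:R * x ^+ d * ((x - y) / x).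
Proof.
move=> x0 y0.
have bern k : 1 - k%:R * (1 - y / x) <= (y / x) ^+ k.
  have r0 : 0 <= y / x by apply: divr_ge0 => //; exact: ltW.
  elim: k => [|k IH]; first by rewrite mul0r subr0 expr0.
  have h2 : 0 <= k%:R * (1 - y / x) ^+ 2 by rewrite mulr_ge0// sqr_ge0.
  rewrite exprSr; apply: le_trans (ler_wpM2r r0 IH).
  rewrite -natr1; move: h2; set u := y / x; nra.
have -> : (x - y) / x = 1 - y / x by rewrite mulrBl divff// gt_eqF.
have xd : 0 < x ^+ d by exact: exprn_gt0.
have := bern d; rewrite expr_div_n ler_pdivlMr//.
move: (x ^+ d) (y ^+ d) (y / x) xd => X Y u X0; nra.
Qed.

(** * Counting cubes and volume outside the blocks *)

Section BlockCounts.
Variables (d r : nat).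
Hypothesis d0 : (0 < d)%N.

Local Notation vol n := (((2 * n) ^ d)%:R : R).
Local Notation L m := (2 * m + r + 1)%N.
Local Notation k m n := ((2 * n) %/ L m)%N.
Local Notation e m n := (m%:R^-1 + m%:R / n%:R : R).
Local Notation C := (d%:R * 3 ^+ d * (2 * r + 7)%:R : R).

Let kL m n : (k m n * L m <= 2 * n)%N.
Proof. exact: leq_divM. Qed.

Let nL m n : (2 * n < (k m n).+1 * L m)%N.
Proof. by rewrite ltn_ceil// addn1. Qed.

Let km m n : (k m n * m <= n)%N.
Proof. have := kL m n; nia. Qed.

Let e_ge0 m n : 0 <= e m n.
Proof. by rewrite addr_ge0 ?invr_ge0 ?divr_ge0. Qed.

(** [D] counts what the blocks miss along one edge: the corridors, proportional to the number of
    blocks, and an incomplete last period. As that number is at most n / m, the corridors contribute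
    order 1/m; since m >= 1, the rest 4m + 2r + 3 is at most (2r + 7) m, which contributes order
    m/n. *)
Let frac_le m n D : (0 < m <= n)%N ->
  (D <= k m n * (2 * r + 1) + 4 * m + 2 * r + 3)%N ->
  D%:R / n%:R <= (2 * r + 7)%:R * e m n.
Proof.
move=> /andP[m0 mn] Dk; have n0 : (0 < n)%N by exact: leq_trans mn.
have -> : e m n = (n + m * m)%:R / (m%:R * n%:R).
  by rewrite natrD natrM; field; rewrite !pnatr_eq0 -!lt0n m0 n0.
rewrite mulrA ler_pdivlMr ?mulr_gt0 ?ltr0n// mulrACA mulVf ?pnatr_eq0 -?lt0n// mulr1.
rewrite -!natrM ler_nat.
apply: (@leq_trans ((k m n * (2 * r + 1) + 4 * m + 2 * r + 3) * m)); first by rewrite leq_mul2r Dk orbT.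
by have := km m n; move: (k m n) => K; nia.
Qed.

(** The factor 3 serves both x = 2n and x = 4n + 1, the latter because 4n + 1 <= 6n. *)
Let pow_gap x y n c : (0 < n)%N -> 0 < x -> 0 <= y ->
  x <= 3 * (2 * n)%:R -> (x - y) / x <= c -> 0 <= c ->
  x ^+ d - y ^+ d <= d%:R * 3 ^+ d * vol n * c.
Proof.
move=> n0 x0 y0 xn xyc c0; apply: le_trans (subrX_le d x0 y0) _.
rewrite -!mulrA ler_wpM2l//; apply: le_trans (ler_wpM2l _ xyc) _.
  by rewrite exprn_ge0// ltW.
rewrite mulrA ler_wpM2r// natrX -exprMn lerXn2r ?nnegrE//; exact: ltW.
Qed.

Lemma block_count_gap m n : (0 < m <= n)%N ->
  (((4 * n + 1) ^ d - (k m n * (4 * m + 1)) ^ d)%N%:R : R) <= C * vol n * e m n.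
Proof.
move=> mn; have n0 : (0 < n)%N by move: mn => /andP[]; exact: leq_trans.
have ky : (k m n * (4 * m + 1) <= 4 * n + 1)%N.
  by have := kL m n; move: (k m n) => K; nia.
have kyd : ((k m n * (4 * m + 1)) ^ d <= (4 * n + 1) ^ d)%N by rewrite leq_exp2r.
rewrite natrB// natrX [X in _ - X]natrX.
have -> : C * vol n * e m n = d%:R * 3 ^+ d * vol n * ((2 * r + 7)%:R * e m n) by ring.
have x0 : 0 < (4 * n + 1)%:R :> R by rewrite ltr0n addn1.
apply: pow_gap => //.
  by rewrite -natrM ler_nat; lia.
rewrite -natrB//; apply: le_trans (frac_le mn (D := 4 * n + 1 - k m n * (4 * m + 1)) _).
  by rewrite ler_wpM2l// lef_pV2 ?posrE ?ltr0n ?addn1// ler_nat; lia.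
by have := nL m n; move: (k m n) => K; nia.
Qed.

Lemma block_volume_gap m n : (0 < m <= n)%N ->
  `|vol n - (k m n ^ d)%:R * vol m| <= C * vol n * e m n.
Proof.
move=> mn; have n0 : (0 < n)%N by move: mn => /andP[]; exact: leq_trans.
have ky : (k m n * (2 * m) <= 2 * n)%N.
  by have := kL m n; move: (k m n) => K; nia.
rewrite -natrM -expnMn ger0_norm ?subr_ge0 ?ler_nat ?leq_exp2r//.
rewrite !natrX.
have -> : C * (2 * n)%:R ^+ d * e m n = d%:R * 3 ^+ d * vol n * ((2 * r + 7)%:R * e m n) by rewrite natrX; ring.
have x0 : 0 < (2 * n)%:R :> R by rewrite ltr0n muln_gt0.
apply: pow_gap => //.
  by rewrite -natrM ler_nat; lia.
rewrite -natrB//; apply: le_trans (frac_le mn (D := 2 * n - k m n * (2 * m)) _).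
  by rewrite ler_wpM2l// lef_pV2 ?posrE ?ltr0n ?muln_gt0// ler_nat; lia.
by have := nL m n; move: (k m n) => K; nia.
Qed.

(** With 4m + 1 <= 5m and k m <= n, the left side is at most 25^d n^d m^d; positivity of [d] then
    gives m^d <= n^d (m / n). *)
Lemma block_variance_count m n : (0 < m <= n)%N ->
  (k m n ^ d)%:R * ((4 * m + 1) ^ d)%:R ^+ 2 <= 25 ^+ d * vol n ^+ 2 * (m%:R / n%:R).
Proof.
move=> /andP[m0 mn]; have n0 : (0 < n)%N by exact: leq_trans mn.
rewrite [leRHS]mulrA ler_pdivlMr ?ltr0n//.
have -> : (25 : R) ^+ d = (25 ^ d)%:R by rewrite natrX.
rewrite -!natrX -!natrM ler_nat.
apply: (@leq_trans ((25 ^ d * (k m n * m) ^ d * m ^ d) * n)).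
  rewrite leq_mul2r; apply/orP; right.
  rewrite -expnM mulnC (mulnC d 2) expnM -!expnMn leq_exp2r//.
  move: (k m n) => K; rewrite !expnS !expn0 !muln1; nia.
apply: (@leq_trans (25 ^ d * n ^ d * (n ^ d * m))).
  rewrite -mulnA; apply: leq_mul; first by rewrite leq_mul2l leq_exp2r// km orbT.
  case: (d) d0 => // d' _; rewrite !expnS.
  have h : (m ^ d' <= n ^ d')%N by case: d' => // d'; rewrite leq_exp2r.
  have := leq_mul (leqnn (m * n)%N) h; move: (m ^ d')%N (n ^ d')%N => a b; nia.
have h : (n ^ d <= (2 * n) ^ d)%N by rewrite leq_exp2r//; lia.
rewrite -mulnn; have := leq_mul (leqnn (25 ^ d * m)%N) (leq_mul h h).
by move: (25 ^ d)%N (n ^ d)%N ((2 * n) ^ d)%N => a b c; nia.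
Qed.

Lemma subbox_count_gap N n : (0 < N <= n)%N ->
  (((4 * n + 1) ^ d - (4 * N + 1) ^ d)%N%:R : R) <= d%:R * 3 ^+ d * vol n * ((n%:R - N%:R) / n%:R).
Proof.
move=> /andP[N0 Nn]; have n0 : (0 < n)%N by exact: leq_trans Nn.
rewrite natrB; last by rewrite leq_exp2r//; lia.
rewrite natrX [X in _ - X]natrX -natrB//.
have x0 : 0 < (4 * n + 1)%:R :> R by rewrite ltr0n addn1.
apply: pow_gap => //.
- by rewrite -natrM ler_nat; lia.
- rewrite -natrB; last lia.
  rewrite ler_pdivrMr// mulrAC ler_pdivlMr ?ltr0n// -!natrM ler_nat.
  by nia.
Qed.

Lemma subbox_volume_gap N n : (0 < N <= n)%N ->
  `|vol n - vol N| <= d%:R * 3 ^+ d * vol n * ((n%:R - N%:R) / n%:R).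
Proof.
move=> /andP[N0 Nn]; have n0 : (0 < n)%N by exact: leq_trans Nn.
rewrite ger0_norm ?subr_ge0 ?ler_nat ?leq_exp2r//; last by lia.
rewrite [in leLHS]natrX [X in _ - X]natrX -natrB//.
have x0 : 0 < (2 * n)%:R :> R by rewrite ltr0n muln_gt0.
apply: pow_gap => //.
- by rewrite -natrM ler_nat; lia.
- rewrite -natrB; last lia.
  by rewrite ler_pdivrMr// mulrAC ler_pdivlMr ?ltr0n// -!natrM ler_nat; nia.

Qed.

End BlockCounts.

(** * Convergence criteria for sequences *)

Lemma cvgn_block_cauchy (a : nat -> R) (C : R) : 0 <= C ->
  (forall m n, (0 < m <= n)%N -> `|a n - a m| <= C * (m%:R^-1 + m%:R / n%:R)) ->
  cvgn a.
Proof.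
move=> C0 H; apply/cauchy_cvgP/cauchy_exP => eps eps0.
(* Compare with the fixed term of index [K]: once n >= K^2, both 1/K and K/n are at most 1/K. *)
pose K := Num.Def.archi_bound ((C + 1) * 4 / eps).
have D0 : 0 <= (C + 1) * 4 / eps.
  by apply: divr_ge0; [apply: mulr_ge0 => //; exact: addr_ge0|exact: ltW].
have CK : (C + 1) * 4 / eps < K%:R by exact: archi_boundP.
have K0 : (0 < K)%N by rewrite -(ltr0n R); exact: le_lt_trans CK.
exists (a K); exists (K * K)%N => // n /= Kn.
rewrite /ball /= distrC; apply: le_lt_trans (H K n _) _.
  by rewrite K0 /=; nia.
have n0 : (0 < n)%N by apply: leq_trans Kn; rewrite muln_gt0 K0.
have h1 : K%:R / n%:R <= K%:R^-1 :> R.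
  by rewrite ler_pdivrMr ?ltr0n// mulrC ler_pdivlMr ?ltr0n// -natrM ler_nat.
apply: (@le_lt_trans _ _ ((C + 1) * 2 / K%:R)).
  rewrite -mulrA ler_pM// ?addr_ge0 ?invr_ge0 ?divr_ge0// ?lerDl//.
  by rewrite mulr2n mulrDl mul1r lerD2l.
rewrite ltr_pdivrMr ?ltr0n//; move: CK; rewrite ltr_pdivrMr//; lra.
Qed.

Lemma fourth_root_floor n : (0 < n)%N -> exists j, (0 < j)%N /\ (j ^ 4 <= n < j.+1 ^ 4)%N.
Proof.
move=> n0; have ex : exists j, (j ^ 4 <= n)%N by exists 0%N.
have bd j : (j ^ 4 <= n)%N -> (j <= n)%N.
  by move=> h; apply: leq_trans h; rewrite -[leqLHS]expn1; case: j => // j; exact: leq_pexp2l.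
case: (ex_maxnP ex bd) => j jn jmax; exists j; split.
  by apply: jmax; rewrite exp1n.
by rewrite jn ltnNge; apply/negP => /jmax; rewrite ltnn.
Qed.

Lemma cvgn_fourth_powers (u : nat -> R) (l C : R) : 0 <= C ->
  (forall N n, (0 < N <= n)%N -> `|u n - u N| <= C * ((n%:R - N%:R) / n%:R)) ->
  u (j ^ 4)%N @[j --> \oo] --> l -> u @ \oo --> l.
Proof.
move=> C0 H /cvgrPdist_lt ul; apply/cvgrPdist_lt => eps eps0.
have e2 : 0 < eps / 2 by rewrite divr_gt0.
have [J _ HJ] := ul _ e2.
pose K := Num.Def.archi_bound ((C + 1) * 30 / eps).
have CK : (C + 1) * 30 / eps < K%:R.
  apply: archi_boundP.
  by apply: divr_ge0; [apply: mulr_ge0 => //; exact: addr_ge0|exact: ltW].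
exists ((maxn J K).+1 ^ 4)%N => // n /= Kn.
have n0 : (0 < n)%N by apply: leq_trans Kn; rewrite expn_gt0.
have [j [j0 /andP[jn nj]]] := fourth_root_floor n0.
have : (maxn J K < j.+1)%N.
  rewrite -(ltn_exp2r _ _ (isT : 0 < 4)%N) (leq_ltn_trans _ nj)//.
  by rewrite (leq_trans _ Kn)// leq_exp2r.
rewrite ltnS geq_max => /andP[Jj Kj].
rewrite -(subrK (u (j ^ 4)%N) l) -addrA (le_lt_trans (ler_normD _ _))// [ltRHS](splitr eps).
rewrite ltr_leD//; first exact: HJ.
rewrite distrC; apply: le_trans (H _ _ _) _; first by rewrite expn_gt0 j0.
(* For j >= 1, (j + 1)^4 - j^4 = 4j^3 + 6j^2 + 4j + 1 is at most 15 j^3, and n >= j^4. The 30 in [K]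
   is twice this 15, to fit in eps / 2. *)
have step : (n%:R - (j ^ 4)%:R) / n%:R <= 15 / j%:R :> R.
  rewrite -natrB// ler_pdivrMr ?ltr0n// mulrAC ler_pdivlMr ?ltr0n// -!natrM ler_nat.
  apply: (@leq_trans (15 * j ^ 4)); last by rewrite leq_mul2l.
  apply: (@leq_trans ((j.+1 ^ 4 - j ^ 4) * j)); first by rewrite leq_mul2r; apply/orP; right; lia.
  have : (1 <= j)%N by []; rewrite !expnS !expn0 !muln1; nia.
apply: le_trans (ler_wpM2l C0 step) _.
have j0' : 0 < j%:R :> R by rewrite ltr0n.
rewrite mulrA ler_pdivrMr//.
have Kj' : K%:R <= j%:R :> R by rewrite ler_nat.
move: (lt_le_trans CK Kj'); rewrite ltr_pdivrMr//; lra.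
Qed.

(** The sharper bound 2 - 1/(k + 1) is what passes through the induction, by telescoping. *)
Lemma sum_inv_sqr_le n : \sum_(0 <= j < n) (j.+1%:R ^+ 2)^-1 <= 2 :> R.
Proof.
suff H k : \sum_(0 <= j < k.+1) (j.+1%:R ^+ 2)^-1 <= 2 - k.+1%:R^-1 :> R.
  case: n => [|n]; first by rewrite big_geq.
  by apply: le_trans (H n) _; rewrite gerBl invr_ge0.
elim: k => [|k IH]; first by rewrite big_nat1 expr1n invr1; lra.
rewrite big_nat_recr//=; apply: le_trans (lerD IH (lexx _)) _.
have k0 : 0 < k.+1%:R :> R by rewrite ltr0n.
rewrite -[k.+2%:R]natr1; move: (k.+1%:R : R) k0 => x x0.
rewrite -subr_ge0.
have -> : 2 - (x + 1)^-1 - (2 - x^-1 + ((x + 1) ^+ 2)^-1) = (x * (x + 1) ^+ 2)^-1.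
  by field; apply/andP; split; lra.
by rewrite invr_ge0 mulr_ge0 ?sqr_ge0// ltW.
Qed.

Lemma cvgn_sqr_summable (u : nat -> R) (K : R) :
  (forall n, \sum_(0 <= j < n) u j ^+ 2 <= K) -> u @ \oo --> 0.
Proof.
move=> uK.
have /cvg_series_cvg_0/cvgrPdist_lt h : cvgn (series (fun j => u j ^+ 2)).
  apply: nondecreasing_is_cvgn.
    by apply/nondecreasing_seqP => n; rewrite !seriesEnat/= big_nat_recr//= lerDl sqr_ge0.
  by exists K => _ [n _ <-]; exact: uK.
apply/cvgrPdist_lt => eps eps0; apply: filterS (h _ (exprn_gt0 2 eps0)) => n.
rewrite !sub0r !normrN normrX => hn.
by rewrite -(ltr_pXn2r (n := 2)) ?nnegrE// ltW.
Qed.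

End Estimates.

(** * Bounded random variables *)

Section FiniteConfigurations.
Variables (disp : measure_display) (T : measurableType disp) (C : finType).

(** The event is a finite union of cells, one for each pair of configurations, and [psi] is constant
    on each cell. *)
Lemma measurable_config (a b : C -> T -> bool) (psi : {set C} -> {set C} -> nat) (U : set nat) :
  (forall c, measurable [set w | a c w]) -> (forall c, measurable [set w | b c w]) ->
  measurable [set w | U (psi [set c | a c w]%SET [set c | b c w]%SET)].
Proof.
move=> ma mb.
pose cell (e : C -> T -> bool) (S : {set C}) := \bigcap_(c in [set: C]) [set w | e c w = (c \in S)].
have mcell (e : C -> T -> bool) S : (forall c, measurable [set w | e c w]) -> measurable (cell e S).
  move=> me; apply: fin_bigcap_measurable => // c _.
  case: (c \in S); first exact: me.
  rewrite [X in measurable X](_ : _ = ~` [set w | e c w]); first exact: measurableC.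
  by apply/seteqP; split=> w /= => [->|/negP/negbTE].
have cellP (e : C -> T -> bool) S w : cell e S w <-> [set c | e c w]%SET = S.
  split=> [h|<- c _ /=]; last by rewrite finset.in_set.
  by apply/setP => c; rewrite finset.in_set h.
rewrite [X in measurable X](_ : _ =
  \bigcup_(S in [set S : {set C} * {set C} | U (psi S.1 S.2)]) (cell a S.1 `&` cell b S.2)).
  apply: fin_bigcup_measurable => //= S _; apply: measurableI; exact: mcell.
apply/seteqP; split=> w /=.
  move=> h; exists ([set c | a c w]%SET, [set c | b c w]%SET) => //.
  by split; apply/cellP.
by move=> [[S S'] /= h [/cellP -> /cellP ->]].
Qed.

End FiniteConfigurations.

Section BoundedVariables.
Variables (R : realType) (disp : measure_display) (Omega : measurableType disp).
Variable P : probability Omega R.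
Implicit Types (f g : Omega -> R) (Y : Omega -> nat).

Definition bounded_measurable f :=
  measurable_fun [set: Omega] f /\ exists K, forall w, `|f w| <= K.

Lemma bounded_measurable_integrable f : bounded_measurable f ->
  P.-integrable [set: Omega] (EFin \o f).
Proof.
move=> [mf [K fK]]; apply: measurable_bounded_integrable => //.
  by apply: le_lt_trans (probability_le1 P _) _ => //; exact: ltry.
exists K; split; first exact: num_real.
by move=> x /ltW Kx w _ /=; exact: le_trans Kx.
Qed.

Lemma bounded_measurable_cst (c : R) : bounded_measurable (fun=> c).
Proof. by split; [exact: measurable_cst|exists `|c|]. Qed.

Lemma bounded_measurableD f g : bounded_measurable f -> bounded_measurable g ->
  bounded_measurable (fun w => f w + g w).
Proof.
move=> [mf [K fK]] [mg [K' gK']]; split; first exact: measurable_funD.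
by exists (K + K') => w; apply: le_trans (ler_normD _ _) (lerD _ _).
Qed.

Lemma bounded_measurableM f g : bounded_measurable f -> bounded_measurable g ->
  bounded_measurable (fun w => f w * g w).
Proof.
move=> [mf [K fK]] [mg [K' gK']]; split; first exact: measurable_funM.
by exists (K * K') => w; rewrite normrM ler_pM.
Qed.

Lemma bounded_measurableB f g : bounded_measurable f -> bounded_measurable g ->
  bounded_measurable (fun w => f w - g w).
Proof.
move=> bf bg; under eq_fun do rewrite -[X in _ + X]mulN1r.
apply: bounded_measurableD => //; apply: bounded_measurableM => //.
exact: bounded_measurable_cst.
Qed.

Lemma bounded_measurable_sum (I : finType) (h : I -> Omega -> R) :
  (forall i, bounded_measurable (h i)) -> bounded_measurable (fun w => \sum_i h i w).
Proof.
move=> bh; elim: (index_enum I) => [|i r IH].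
  by under eq_fun do rewrite big_nil; exact: bounded_measurable_cst.
by under eq_fun do rewrite big_cons; exact: bounded_measurableD.
Qed.

Lemma bounded_measurable_nat Y K : (forall U, measurable (Y @^-1` U)) ->
  (forall w, (Y w <= K)%N) -> bounded_measurable (fun w => (Y w)%:R).
Proof.
move=> mY YK; split; last by exists K%:R => w; rewrite normr_nat ler_nat.
by move=> _ B mB; rewrite setTI; exact: (mY [set k | B k%:R]).
Qed.

Lemma bounded_measurable_indic A : measurable A -> bounded_measurable (\1_A : Omega -> R).
Proof.
move=> mA; split; first exact: measurable_indic.
by exists 1 => w; rewrite indicE; case: (_ \in _); rewrite ?normr1 ?normr0.
Qed.

Local Notation Ex f := (Rintegral P setT f).

Lemma mean_cst (c : R) : Ex (fun=> c) = c.
Proof. by rewrite Rintegral_cst// [X in fine X](_ : _ = 1%E) ?mulr1//; exact: probability_setT. Qed.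

Lemma meanD f g : bounded_measurable f -> bounded_measurable g ->
  Ex (fun w => f w + g w) = Ex f + Ex g.
Proof. by move=> bf bg; rewrite RintegralD//; exact: bounded_measurable_integrable. Qed.

Lemma meanB f g : bounded_measurable f -> bounded_measurable g ->
  Ex (fun w => f w - g w) = Ex f - Ex g.
Proof. by move=> bf bg; rewrite RintegralB//; exact: bounded_measurable_integrable. Qed.

Lemma meanZ c f : bounded_measurable f -> Ex (fun w => c * f w) = c * Ex f.
Proof. by move=> bf; rewrite RintegralZl//; exact: bounded_measurable_integrable. Qed.

Lemma mean_le f g : bounded_measurable f -> bounded_measurable g ->
  (forall w, f w <= g w) -> Ex f <= Ex g.
Proof. by move=> bf bg fg; apply: le_Rintegral => //; exact: bounded_measurable_integrable. Qed.

Lemma mean_norm_le f K : bounded_measurable f -> (forall w, `|f w| <= K) -> `|Ex f| <= K.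
Proof.
move=> bf fK; have bK := bounded_measurable_cst; rewrite ler_norml -(mean_cst (- K)) -{2}(mean_cst K).
by apply/andP; split; apply: mean_le => // w; have := fK w; rewrite ler_norml => /andP[].
Qed.

Lemma mean_sum (I : finType) (h : I -> Omega -> R) : (forall i, bounded_measurable (h i)) ->
  Ex (fun w => \sum_i h i w) = \sum_i Ex (h i).
Proof.
move=> bh; elim: (index_enum I) => [|i r IH].
  by rewrite big_nil; under eq_fun do rewrite big_nil; exact: mean_cst.
rewrite big_cons -IH -meanD//; first by under eq_fun do rewrite big_cons.
elim: r {IH} => [|j r IH].
  by under eq_fun do rewrite big_nil; exact: bounded_measurable_cst.
by under eq_fun do rewrite big_cons; exact: bounded_measurableD.
Qed.

Lemma mean_indic A : measurable A -> Ex (\1_A : Omega -> R) = fine (P A).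
Proof. by move=> mA; rewrite /Rintegral integral_indic// setIT. Qed.

Lemma nat_levels Y K w : (forall w, (Y w <= K)%N) ->
  (Y w)%:R = \sum_(k < K.+1) k%:R * \1_(Y @^-1` [set val k]) w :> R.
Proof.
move=> YK; rewrite (bigD1 (inord (Y w)))//= inordK ?ltnS// big1 => [|k kY].
  by rewrite indicE mem_set// mulr1 addr0.
rewrite indicE memNset ?mulr0//= => Yk; move: kY; rewrite Yk.
by rewrite inord_val eqxx.
Qed.

Lemma mean_levels Y K : (forall U, measurable (Y @^-1` U)) -> (forall w, (Y w <= K)%N) ->
  Ex (fun w => (Y w)%:R) = \sum_(k < K.+1) k%:R * fine (P (Y @^-1` [set val k])).
Proof.
move=> mY YK; under eq_fun do rewrite (nat_levels _ YK).
have bY k := bounded_measurable_indic (mY [set k]).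
rewrite mean_sum => [|k]; last by apply: bounded_measurableM => //; exact: bounded_measurable_cst.
by apply: eq_bigr => k _; rewrite meanZ// mean_indic.
Qed.

(** Both variables are finite combinations of indicators of their level sets, so the product rule
    reduces to independence of events. *)
Lemma mean_mul_indep Y Y' K : (forall U, measurable (Y @^-1` U)) ->
  (forall U, measurable (Y' @^-1` U)) ->
  (forall w, (Y w <= K)%N) -> (forall w, (Y' w <= K)%N) ->
  (forall U U', P (Y @^-1` U `&` Y' @^-1` U') = (P (Y @^-1` U) * P (Y' @^-1` U'))%E) ->
  Ex (fun w => (Y w)%:R * (Y' w)%:R) = Ex (fun w => (Y w)%:R) * Ex (fun w => (Y' w)%:R).
Proof.
move=> mY mY' YK YK' ind; rewrite !(@mean_levels _ K)// big_distrlr/=.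
under eq_fun do rewrite (nat_levels _ YK) (nat_levels _ YK') big_distrlr/=.
have bY k := bounded_measurable_indic (mY [set k]).
have bY' k := bounded_measurable_indic (mY' [set k]).
have bc := bounded_measurable_cst.
have bl i j : bounded_measurable (fun w => i%:R * \1_(Y @^-1` [set i]) w * (j%:R * \1_(Y' @^-1` [set j]) w)).
  by do !apply: bounded_measurableM.
rewrite mean_sum => [|i]; last by apply: bounded_measurable_sum => j; exact: bl.
apply: eq_bigr => i _; rewrite mean_sum => [|j]; last exact: bl.
apply: eq_bigr => j _.
transitivity (Ex (fun w => (i%:R * j%:R) * \1_(Y @^-1` [set val i] `&` Y' @^-1` [set val j]) w)).
  by congr (Rintegral _ _ _); apply/funext => w; rewrite indicI/=; ring.
have mI : measurable (Y @^-1` [set val i] `&` Y' @^-1` [set val j]) by exact: measurableI.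
rewrite meanZ ?mean_indic//; last exact: bounded_measurable_indic.
rewrite ind fineM; [by rewrite mulrACA|exact: fin_num_measure|exact: fin_num_measure].
Qed.

Lemma mean_mul_centered f g : bounded_measurable f -> bounded_measurable g ->
  Ex (fun w => f w * g w) = Ex f * Ex g ->
  Ex (fun w => (f w - Ex f) * (g w - Ex g)) = 0.
Proof.
move=> bf bg fg; have bc := bounded_measurable_cst.
set mu := Ex f; set nu := Ex g; rewrite -/mu -/nu in fg.
transitivity (Ex (fun w => f w * g w - (nu * f w + mu * g w - mu * nu))).
  by congr (Rintegral _ _ _); apply/funext => w /=; ring.
have b1 := bounded_measurableM (bc nu) bf.
have b2 := bounded_measurableM (bc mu) bg.
have b3 := bounded_measurableD b1 b2.
rewrite meanB; [|exact: bounded_measurableM|exact: bounded_measurableB].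
by rewrite meanB// meanD// !meanZ// mean_cst fg -/mu -/nu; ring.
Qed.

Lemma mean_sqr_sum_uncorrelated (I : finType) (Z : I -> Omega -> R) K :
  (forall i, bounded_measurable (Z i)) -> (forall i w, `|Z i w| <= K) ->
  (forall i j, i != j -> Ex (fun w => Z i w * Z j w) = 0) ->
  Ex (fun w => (\sum_i Z i w) ^+ 2) <= #|I|%:R * K ^+ 2.
Proof.
move=> bZ ZK uncorr.
have bZZ i j : bounded_measurable (fun w => Z i w * Z j w) by exact: bounded_measurableM.
under eq_fun do rewrite expr2 big_distrlr/=.
rewrite mean_sum => [|i]; last exact: bounded_measurable_sum.
rewrite -sum1_card natr_sum mulr_suml; apply: ler_sum => i _.
rewrite mul1r mean_sum// (bigD1 i)//= big1 ?addr0 => [|j ji]; last by rewrite uncorr// eq_sym.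
apply: le_trans (ler_norm _) _; apply: mean_norm_le => // w.
by rewrite normrM expr2 ler_pM.
Qed.

(** By monotone convergence the sum of the squares has mean at most 2C, so it is almost surely
    finite and its terms tend to 0. *)
Lemma ae_cvg0_of_summable_sqr (h : nat -> Omega -> R) C :
  (forall j, bounded_measurable (h j)) ->
  (forall j, Ex (fun w => h j w ^+ 2) <= C / j.+1%:R ^+ 2) ->
  {ae P, forall w, h j w @[j --> \oo] --> 0}.
Proof.
move=> bh hC.
have bh2 j : bounded_measurable (fun w => h j w ^+ 2) by exact: bounded_measurableM.
have C0 : 0 <= C.
  have := hC 0%N; rewrite expr1n divr1; apply: le_trans.
  by apply: Rintegral_ge0 => w _; exact: sqr_ge0.
have mh j : measurable_fun [set: Omega] (fun w => (h j w ^+ 2)%:E).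
  by apply/measurable_EFinP; case: (bh2 j).
have h0 j w : (0 <= (h j w ^+ 2)%:E)%E by rewrite lee_fin sqr_ge0.
pose S w : \bar R := (\sum_(0 <= j <oo) (h j w ^+ 2)%:E)%E.
have S0 w : (0 <= S w)%E by exact: nneseries_ge0.
have mS : measurable_fun [set: Omega] S by exact: ge0_emeasurable_sum.
have IS : (\int[P]_w S w <= (C * 2)%:E)%E.
  rewrite integral_nneseries//; apply: lime_le.
    by apply: is_cvg_nneseries => j _ _; exact: integral_ge0.
  apply: nearW => n.
  have E j : (\int[P]_w (h j w ^+ 2)%:E = (Ex (fun w => h j w ^+ 2)%R)%:E)%E.
    by rewrite /Rintegral fineK//; apply: integrable_fin_num => //; exact: bounded_measurable_integrable.
  under eq_bigr do rewrite E; rewrite sumEFin lee_fin.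
  apply: le_trans (ler_wpM2l C0 (sum_inv_sqr_le R n)).
  by rewrite mulr_sumr; apply: ler_sum => j _; exact: hC.
have iS : P.-integrable [set: Omega] S.
  apply/integrableP; split=> //; under eq_integral do rewrite gee0_abs//.
  by apply: le_lt_trans IS _; rewrite ltry.
apply: filterS (integrable_ae measurableT iS) => w /(_ I) Sfin.
apply: (@cvgn_sqr_summable _ _ (fine (S w))) => n.
rewrite -lee_fin fineK// -sumEFin; exact: nneseries_lim_ge.
Qed.

End BoundedVariables.

(** * A law of large numbers for almost additive processes *)

(** [A] and [V] are the quantity and the volume at the large scale, [B] and [W] those at the small
    scale, and [c] is the number of blocks. The error in [V] is weighted by the density B / W,
    bounded by [M]. *)
Lemma normalized_diff_le (R : realType) (A B V W c D M eps : R) :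
  0 < V -> 0 < W -> 0 <= D -> 0 <= eps ->
  `|A - c * B| <= D * V * eps -> `|V - c * W| <= D * V * eps -> `|B| <= M * W ->
  `|A / V - B / W| <= D * (1 + M) * eps.
Proof.
move=> V0 W0 D0 e0 hA hV hB.
have -> : A / V - B / W = ((A - c * B) - B / W * (V - c * W)) / V.
  by field; rewrite !gt_eqF.
rewrite normrM normfV (gtr0_norm V0) ler_pdivrMr//.
apply: le_trans (ler_normB _ _) _; rewrite normrM.
have hBW : `|B / W| <= M by rewrite normrM normfV (gtr0_norm W0) ler_pdivrMr.
have -> : D * (1 + M) * eps * V = D * V * eps + M * (D * V * eps) by ring.
by apply: lerD => //; apply: ler_pM.
Qed.

Section AlmostAdditive.
Variables (R : realType) (disp : measure_display) (Omega : measurableType disp).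
Variables (P : probability Omega R) (d r : nat) (F : nat -> Omega -> R).
Hypothesis d0 : (0 < d)%N.

Local Notation Ex f := (Rintegral P setT f).
Local Notation vol n := (((2 * n) ^ d)%:R : R).
Local Notation card n := ((4 * n + 1) ^ d)%N.
Local Notation k m n := ((2 * n) %/ (2 * m + r + 1))%N.
Local Notation mu n := (Ex (F n)).
Local Notation gap m n := (((4 * n + 1) ^ d - (k m n * (4 * m + 1)) ^ d)%N%:R : R).
Local Notation e m n := (m%:R^-1 + m%:R / n%:R : R).
Local Notation C := (d%:R * 3 ^+ d * (2 * r + 7)%:R : R).

Hypothesis Fbounded : forall n, bounded_measurable (F n).
Hypothesis Fcard : forall n w, 0 <= F n w <= (card n)%:R.
Hypothesis Fsub : forall N n w, (N <= n)%N -> `|F n w - F N w| <= (card n - card N)%N%:R.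
(** Blocks enter only through first and second moments: stationarity will supply the equal means,
    and [r]-dependence the vanishing covariances. *)
Hypothesis Fblocks : forall m n, exists (I : finType) (Z : I -> Omega -> R),
  [/\ #|I| = (k m n ^ d)%N,
      (forall i, bounded_measurable (Z i)) /\ (forall i w, 0 <= Z i w <= (card m)%:R),
      forall i, Ex (Z i) = mu m,
      forall i j, i != j -> Ex (fun w => (Z i w - mu m) * (Z j w - mu m)) = 0 &
      forall w, `|F n w - \sum_i Z i w| <= gap m n].

Let C_ge0 : 0 <= C. Proof. by rewrite !mulr_ge0// ?exprn_ge0. Qed.

Let e_ge0 m n : 0 <= e m n.
Proof. by rewrite addr_ge0 ?invr_ge0 ?divr_ge0. Qed.

Let vol_gt0 n : (0 < n)%N -> 0 < vol n.
Proof. by move=> n0; rewrite ltr0n expn_gt0 muln_gt0 n0. Qed.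

Let card_le n : (0 < n)%N -> (card n)%:R <= 3 ^+ d * vol n.
Proof. by move=> n0; rewrite -natrX -natrM ler_nat -expnMn leq_exp2r//; lia. Qed.

Let mean_card n : 0 <= mu n <= (card n)%:R.
Proof.
rewrite Rintegral_ge0 => [|w _]; last by case/andP: (Fcard n w).
apply: le_trans (ler_norm _) _; apply: mean_norm_le => // w.
by have /andP[h1 h2] := Fcard n w; rewrite ger0_norm.
Qed.

Lemma mean_gap m n : `|mu n - (k m n ^ d)%:R * mu m| <= gap m n.
Proof.
have [I [Z [cI [bZ _] mZ _ FZ]]] := Fblocks m n.
have -> : (k m n ^ d)%:R * mu m = Ex (fun w => \sum_i Z i w).
  by rewrite mean_sum// (eq_bigr (fun=> mu m))// sumr_const cI mulr_natl.
have bS := bounded_measurable_sum bZ.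
by rewrite -meanB//; apply: mean_norm_le => //; exact: bounded_measurableB.
Qed.

Lemma normalized_mean_cauchy m n : (0 < m <= n)%N ->
  `|mu n / vol n - mu m / vol m| <= C * (1 + 3 ^+ d) * e m n.
Proof.
move=> mn; have /andP[m0 /(leq_trans m0) n0] := mn.
apply: (normalized_diff_le (c := (k m n ^ d)%:R)); rewrite ?vol_gt0//.
- exact: le_trans (mean_gap m n) (block_count_gap R r d0 mn).
- exact: block_volume_gap.
- have /andP[h1 h2] := mean_card m; rewrite ger0_norm//.
  exact: le_trans h2 (card_le m0).
Qed.

Lemma normalized_sub_le N n w : (0 < N <= n)%N ->
  `|F n w / vol n - F N w / vol N| <= d%:R * 3 ^+ d * (1 + 3 ^+ d) * ((n%:R - N%:R) / n%:R).
Proof.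
move=> Nn; have /andP[N0 Nn'] := Nn; have n0 := leq_trans N0 Nn'.
apply: (normalized_diff_le (c := 1)); rewrite ?vol_gt0 ?mul1r//.
- by rewrite divr_ge0// subr_ge0 ler_nat.
- exact: le_trans (Fsub w Nn') (subbox_count_gap R d0 Nn).
- exact: subbox_volume_gap.
- have /andP[h1 h2] := Fcard N w; rewrite ger0_norm//.
  exact: le_trans h2 (card_le N0).
Qed.

(** The deviation is [u] plus the centered block sum, where |u| <= 2 gap since both [F n] and its
    mean are within one gap of their block versions. Then (u + v)^2 <= 2u^2 + 2v^2 gives 8 gap^2 and
    twice the variance of the sum. *)
Lemma mean_sqr_deviation m n : Ex (fun w => (F n w - mu n) ^+ 2) <=
  8 * gap m n ^+ 2 + 2 * ((k m n ^ d)%:R * (card m)%:R ^+ 2).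
Proof.
have [I [Z [cI [bZ cZ] mZ uZ FZ]]] := Fblocks m n.
have bc := bounded_measurable_cst Omega (R := R).
have bY i : bounded_measurable (fun w => Z i w - mu m) by exact: bounded_measurableB.
have YK i w : `|Z i w - mu m| <= (card m)%:R.
  have /andP[h1 h2] := mean_card m; have /andP[h3 h4] := cZ i w.
  by rewrite ler_norml; apply/andP; split; lra.
have hS := mean_sqr_sum_uncorrelated bY YK uZ.
rewrite cI in hS.
have bS2 : bounded_measurable (fun w => (\sum_i (Z i w - mu m)) ^+ 2).
  by apply: bounded_measurableM; exact: bounded_measurable_sum.
have b2 := bounded_measurableM (bc 2) bS2.
apply: (@le_trans _ _ (Ex (fun w => 8 * gap m n ^+ 2 + 2 * (\sum_i (Z i w - mu m)) ^+ 2))).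
  apply: mean_le => [||w].
  - by apply: bounded_measurableM; exact: bounded_measurableB.
  - exact: bounded_measurableD.
  have h1 := FZ w; have h2 := mean_gap m n.
  have hs : \sum_i (Z i w - mu m) = \sum_i Z i w - (k m n ^ d)%:R * mu m.
    by rewrite sumrB sumr_const cI mulr_natl.
  move: h1 h2; rewrite hs; move: (gap m n) (F n w) (mu n) (\sum_i Z i w) (_ * mu m) => g x y S T.
  rewrite !ler_norml => /andP[a1 a2] /andP[a3 a4].
  set u := x - S - (y - T).
  have -> : x - y = u + (S - T) by rewrite /u; ring.
  have u2 : u ^+ 2 <= 4 * g ^+ 2.
    have : 0 <= (2 * g - u) * (2 * g + u) by apply: mulr_ge0; rewrite /u; lra.
    nra.
  have := sqr_ge0 (u - (S - T)); nra.
rewrite meanD// mean_cst meanZ// lerD2l ler_wpM2l//.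
Qed.

Lemma normalized_deviation_summable j (n := (j.+1 ^ 4)%N) :
  Ex (fun w => ((F n w - mu n) / vol n) ^+ 2) <= (32 * C ^+ 2 + 2 * 25 ^+ d) / j.+1%:R ^+ 2.
Proof.
(* With m^2 = n the errors 1/m and m/n coincide, both being 1/(j + 1)^2. The squared gap even has
   order (j + 1)^-4 relative to the squared volume; one factor is dropped to match the variance
   term. *)
pose m := (j.+1 ^ 2)%N.
have mn : (0 < m <= n)%N by rewrite /m /n expn_gt0/= leq_pexp2l.
have n0 : (0 < n)%N by rewrite expn_gt0.
have bc := bounded_measurable_cst Omega (R := R).
have bF : bounded_measurable (fun w => (F n w - mu n) ^+ 2).
  by apply: bounded_measurableM; exact: bounded_measurableB.
have -> : Ex (fun w => ((F n w - mu n) / vol n) ^+ 2) = (vol n ^+ 2)^-1 * Ex (fun w => (F n w - mu n) ^+ 2).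
  rewrite -meanZ//; congr (Rintegral _ _ _); apply/funext => w.
  by rewrite expr_div_n mulrC.
have V0 := vol_gt0 n0.
rewrite mulrC ler_pdivrMr ?exprn_gt0//.
apply: le_trans (mean_sqr_deviation m n) _.
have h1 := block_count_gap R r d0 mn; have h2 := block_variance_count R r d0 mn.
have J0 : 0 < j.+1%:R :> R by rewrite ltr0n.
have J1 : 1 <= j.+1%:R :> R by rewrite ler1n.
have eE : e m n = 2 / j.+1%:R ^+ 2.
  by rewrite /m /n !natrX; field; rewrite gt_eqF.
have mnE : m%:R / n%:R = (j.+1%:R ^+ 2)^-1 :> R.
  by rewrite /m /n !natrX; field; rewrite gt_eqF.
rewrite eE in h1; rewrite mnE in h2.
have g0 : 0 <= gap m n by rewrite ler0n.
have h3 : gap m n ^+ 2 <= 4 * C ^+ 2 * vol n ^+ 2 / j.+1%:R ^+ 2.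
  apply: (@le_trans _ _ ((C * vol n * (2 / j.+1%:R ^+ 2)) ^+ 2)).
    by rewrite lerXn2r// nnegrE// mulr_ge0// ?mulr_ge0// ltW.
  have -> : (C * vol n * (2 / j.+1%:R ^+ 2)) ^+ 2 = 4 * C ^+ 2 * vol n ^+ 2 / j.+1%:R ^+ 2 * (j.+1%:R ^+ 2)^-1.
    by field; rewrite gt_eqF.
  by rewrite ler_piMr// invf_le1 ?exprn_gt0// exprn_ege1.
rewrite [leRHS](_ : _ = 8 * (4 * C ^+ 2 * vol n ^+ 2 / j.+1%:R ^+ 2)
  + 2 * (25 ^+ d * vol n ^+ 2 * (j.+1%:R ^+ 2)^-1)); last by ring.
by apply: lerD; rewrite ler_wpM2l.
Qed.

Lemma almost_additive_lln : exists bhat : R, [/\ 0 <= bhat,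
  mu n / vol n @[n --> \oo] --> bhat &
  {ae P, forall w, F n w / vol n @[n --> \oo] --> bhat}].
Proof.
have D0 : 0 <= C * (1 + 3 ^+ d) by rewrite mulr_ge0// ?addr_ge0// ?exprn_ge0.
have mucvg := cvgn_block_cauchy D0 normalized_mean_cauchy.
exists (lim ((mu n / vol n) @[n --> \oo])); split=> //.
  by apply: limr_ge => //; apply: nearW => n; rewrite divr_ge0//; case/andP: (mean_card n).
set bhat := lim _.
have bh j : bounded_measurable (fun w => (F (j.+1 ^ 4)%N w - mu (j.+1 ^ 4)%N) / vol (j.+1 ^ 4)%N).
  have bc := bounded_measurable_cst Omega (R := R).
  by apply: bounded_measurableM => //; exact: bounded_measurableB.
apply: filterS (ae_cvg0_of_summable_sqr bh normalized_deviation_summable) => w h0.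
apply: (cvgn_fourth_powers _ (fun N n => @normalized_sub_le N n w)).
  by rewrite !mulr_ge0// ??addr_ge0// ?exprn_ge0.
(* The summable deviations are indexed by fourth powers of j + 1, which avoids the box of volume
   zero. *)
rewrite -cvg_shiftS /=.
have sub : mu (j.+1 ^ 4)%N / vol (j.+1 ^ 4)%N @[j --> \oo] --> bhat.
  move/cvgrPdist_lt: mucvg => mucvg; apply/cvgrPdist_lt => eps /mucvg[N _ hN].
  exists N => // j /= Nj; apply: hN => /=; apply: leq_trans Nj _.
  by apply: leq_trans (leqnSn _) _; rewrite -[leqLHS]expn1 leq_pexp2l.
rewrite -[bhat]add0r; apply: cvg_trans (cvgD h0 sub); apply: near_eq_cvg.
by apply: nearW => j /=; rewrite -mulrDl subrK.
Qed.

End AlmostAdditive.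

(** * Persistent Betti numbers of random cubical filtrations *)

(** The finite-cell argument is run in a generated sigma-algebra; it serves both the law on the
    space of birth times and the local sigma-algebras of the dependence condition. *)
Lemma smallest_measurable_config (T : pointedType) (G : set (set T)) (C : finType)
    (a b : C -> T -> bool) (psi : {set C} -> {set C} -> nat) (U : set nat) :
  (forall c, G [set w | a c w]) -> (forall c, G [set w | b c w]) ->
  smallest (sigma_algebra setT) G [set w | U (psi [set c | a c w]%SET [set c | b c w]%SET)].
Proof.
move=> Ga Gb.
by apply: (@measurable_config _ (g_sigma_algebraType G : measurableType _) C a b psi U) => c;
  exact: sub_sigma_algebra.
Qed.

Section RandomCubicalFiltration.
Variables (R : realType) (d : nat) (disp : measure_display).
Variables (Omega : measurableType disp) (P : probability Omega R).
Variables (X : Omega -> R -> set ('I_d -> R)) (r q : nat) (s t : R).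
Hypothesis Xrandom : random_cubical_filtration X.
Hypothesis Xstationary : stationary P X.
Hypothesis Xdep : R_dependent P X r.

Local Notation shift := (@Defs.shift d).
Local Notation Ex f := (Rintegral P setT f).
Local Notation rank n := (box_rank q s t n).
Local Notation window c m := (@real_box R d (fun i => c i - m%:Z) (fun i => c i + m%:Z)).

(** Shifting the birth times by [c] amounts to moving the box, so this is the persistent rank in
    [window c m]. *)
Definition local_rank m (c : 'I_d -> int) w : nat := rank m (birth (X w) \o shift c).

Lemma local_rank0 m w : local_rank m (fun=> 0) w = rank m (birth (X w)).
Proof.
congr box_rank; apply/funext => Q /=; congr birth.
by case: Q => l e; congr pair; apply/ffunP => i; rewrite !ffunE addr0.
Qed.

Let le_set (u : R) : set (\bar R) := [set x | (x <= u%:E)%E].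

Let measurable_le u : measurable (le_set u).
Proof. by rewrite /le_set -set_itvNyc; exact: emeasurable_itv. Qed.

Lemma local_rank_birth_sigma m c (U : set nat) :
  birth_sigma X (window c m) (local_rank m c @^-1` U).
Proof.
have [psi E] := box_rank_config d q s t m.
rewrite [X in birth_sigma _ _ X](_ : _ = [set w | U (psi
  [set k : box_code d m | (birth (X w) (shift c (decode_cube k)) <= s%:E)%E]%SET
  [set k : box_code d m | (birth (X w) (shift c (decode_cube k)) <= t%:E)%E]%SET)]); last first.
  by apply/seteqP; split=> w /=; rewrite /local_rank E.
have h u (k : box_code d m) : exists Q (B : set (\bar R)),
    cube_set Q `<=` window c m /\ measurable B /\
    [set w | (birth (X w) (shift c (decode_cube k)) <= u%:E)%E] = (fun w => birth (X w) Q) @^-1` B.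
  exists (shift c (decode_cube k)), (le_set u); split=> //.
  apply/cube_set_real_box => i; have : range (@decode_cube d m) (decode_cube k) by exists k.
  by rewrite range_decode => /(_ i); rewrite /= !ffunE; lia.
rewrite /birth_sigma; apply: (@smallest_measurable_config _ _ _
  (fun k w => (birth (X w) (shift c (decode_cube k)) <= s%:E)%E)
  (fun k w => (birth (X w) (shift c (decode_cube k)) <= t%:E)%E) psi U) => k; exact: h.
Qed.

Lemma birth_sigma_measurable A E : birth_sigma X A E -> measurable E.
Proof.
apply: smallest_sub; first exact: sigma_algebra_measurable.
move=> _ [Q [B [_ [mB ->]]]]; rewrite -[X in measurable X]setTI.
by case: Xrandom => _ mX; exact: mX.
Qed.

Lemma local_rank_measurable m c (U : set nat) : measurable (local_rank m c @^-1` U).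
Proof. exact: birth_sigma_measurable (@local_rank_birth_sigma m c U). Qed.

Lemma local_rank_le m c w : (local_rank m c w <= (4 * m + 1) ^ d)%N.
Proof. exact: box_rank_le. Qed.

Let bounded_local_rank m c : bounded_measurable (fun w => (local_rank m c w)%:R : R).
Proof. exact: bounded_measurable_nat (@local_rank_measurable m c) (local_rank_le m c). Qed.

(** The mean is determined by the probabilities of the levels, and each level is the preimage of one
    event in [family_sigma], to which stationarity applies. *)
Lemma mean_local_rank m c :
  Ex (fun w => (local_rank m c w)%:R) = Ex (fun w => (local_rank m (fun=> 0) w)%:R).
Proof.
rewrite !(mean_levels _ (@local_rank_measurable m _) (local_rank_le m _)).
apply: eq_bigr => k _; congr (_ * fine _); apply/esym.
have [psi E] := box_rank_config d q s t m.
pose A : set (cube d -> \bar R) := [set g | rank m g = k].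
have mA : family_sigma A.
  rewrite /family_sigma [X in smallest _ _ X](_ : _ = [set g | [set val k] (psi
    [set k : box_code d m | (g (decode_cube k) <= s%:E)%E]%SET
    [set k : box_code d m | (g (decode_cube k) <= t%:E)%E]%SET)]); last first.
    by apply/seteqP; split=> g /=; rewrite /A/= E.
  have h u (c' : box_code d m) : exists Q (B : set (\bar R)), measurable B /\
      [set g : cube d -> \bar R | (g (decode_cube c') <= u%:E)%E] = [set f | B (f Q)].
    by exists (decode_cube c'), (le_set u).
  apply: (@smallest_measurable_config (cube d -> \bar R : pointedType) _ _
    (fun k g => (g (decode_cube k) <= s%:E)%E)
    (fun k g => (g (decode_cube k) <= t%:E)%E) psi [set val k]) => c'; exact: h.
have := Xstationary c mA; congr (P _ = P _).
by apply/seteqP; split=> w /=; rewrite local_rank0.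
Qed.

Section Decomposition.
Variables (m n : nat).
Local Notation L := (2 * m + r + 1)%N.
Local Notation k := ((2 * n) %/ L)%N.
Local Notation center z := (@block_center d m n L k z).
Local Notation gap := ((4 * n + 1) ^ d - (k * (4 * m + 1)) ^ d)%N.

Lemma blocks_far (z z' : {ffun 'I_d -> 'I_k}) : z != z' ->
  ((r%:R)%:E < dist_max (window (center z) m) (window (center z') m))%E.
Proof.
move=> zz'; apply: (@lt_le_trans _ _ (r.+1%:R)%:E); first by rewrite lte_fin ltr_nat.
apply: le_ereal_inf_tmp => _ [_ [x [y [xz [yz ->]]]] <-]; rewrite lee_fin.
have [i zi] : exists i, z i != z' i.
  by apply/existsP; apply: contraNT zz' => /existsPn h; apply/eqP/ffunP => i; apply/eqP/negPn; exact: h.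
apply: le_trans (le_bigmax _ _ i).
have [x1 x2] := xz i; have [y1 y2] := yz i.
have far (a b : 'I_k) : (a < b)%N ->
    r.+1%:R <= ((b * L + m)%N%:Z - n%:Z - m%:Z)%:~R - ((a * L + m)%N%:Z - n%:Z + m%:Z)%:~R :> R.
  move=> ab; rewrite -intrB -[r.+1%:R]/((r.+1%:Z)%:~R) ler_int.
  by have : (a.+1 * L <= b * L)%N by [rewrite leq_mul2r ab orbT]; rewrite mulSnr; lia.
move: zi; rewrite neq_ltn => /orP[] /far h.
  by rewrite distrC; apply: le_trans (ler_norm _); apply: le_trans h _; exact: lerB.
by apply: le_trans (ler_norm _); apply: le_trans h _; exact: lerB.
Qed.

Lemma uncorrelated_blocks (z z' : {ffun 'I_d -> 'I_k})
    (mu := Ex (fun w => (local_rank m (fun=> 0) w)%:R)) :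
  z != z' ->
  Ex (fun w => ((local_rank m (center z) w)%:R - mu) * ((local_rank m (center z') w)%:R - mu)) = 0.
Proof.
move=> zz'; set Y := local_rank m (center z); set Y' := local_rank m (center z').
have YK := local_rank_le m (center z); have Y'K := local_rank_le m (center z').
have mY := @local_rank_measurable m (center z); have mY' := @local_rank_measurable m (center z').
have ind U U' := Xdep (blocks_far zz') (@local_rank_birth_sigma m _ U) (@local_rank_birth_sigma m _ U').
have := mean_mul_centered (bounded_measurable_nat R mY YK) (bounded_measurable_nat R mY' Y'K)
  (mean_mul_indep mY mY' YK Y'K ind).
by rewrite !mean_local_rank.
Qed.

Lemma local_rank_blocks w :
  `|(local_rank n (fun=> 0) w)%:R - \sum_z (local_rank m (center z) w)%:R| <= gap%:R :> R.
Proof.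
have mL : (2 * m < L)%N by lia.
have [h1 h2] := box_rank_blocks q s t mL (leq_divM (2 * n) L) (birth (X w)).
rewrite local_rank0 -natr_sum ler_norml lerBlDl lerNl opprB lerBlDl -!natrD !ler_nat.
by rewrite h1 h2.
Qed.

End Decomposition.
Lemma local_rank_lln : (0 < d)%N -> exists bhat : R, [/\ 0 <= bhat,
  Ex (fun w => (local_rank n (fun=> 0) w)%:R) / ((2 * n) ^ d)%:R @[n --> \oo] --> bhat &
  {ae P, forall w, (local_rank n (fun=> 0) w)%:R / ((2 * n) ^ d)%:R @[n --> \oo] --> bhat}].
Proof.
move=> d0; pose F n w : R := (local_rank n (fun=> 0) w)%:R.
apply: (@almost_additive_lln _ _ _ P d r F d0).
- by move=> n; exact: bounded_local_rank.
- by move=> n w; rewrite ler0n ler_nat local_rank_le.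
- move=> N n w Nn; rewrite /F !local_rank0.
  have [h1 h2] := box_rank_subbox q s t (birth (X w)) Nn.
  by rewrite ler_norml lerBlDl lerNl opprB lerBlDl -!natrD !ler_nat h1 h2.
- move=> m n; pose center z := @block_center d m n (2 * m + r + 1) ((2 * n) %/ (2 * m + r + 1)) z.
  exists {ffun 'I_d -> 'I_((2 * n) %/ (2 * m + r + 1))}, (fun z w => (local_rank m (center z) w)%:R).
  split.
  + by rewrite card_ffun !card_ord.
  + split=> [z|z w]; first exact: bounded_local_rank.
    by rewrite ler0n ler_nat local_rank_le.
  + by move=> z; exact: mean_local_rank.
  + by move=> z z'; exact: uncorrelated_blocks.
  + by move=> w; exact: local_rank_blocks.
Qed.

End RandomCubicalFiltration.

Theorem mainTheorem1 (R : realType) (d : nat) (d0 : measure_display)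
  (Omega : measurableType d0) (P : probability Omega R)
  (X : Omega -> R -> set ('I_d -> R)) (Rd q : nat) (s t : R) :
  random_cubical_filtration X ->
  stationary P X ->
  R_dependent P X Rd ->
  (q < d)%N -> 0 <= s -> s <= t ->
  exists bhat : R, 0 <= bhat /\
    ((fun n : nat =>
        ((\int[P]_w ((pbetti q (restrictX (X w) n) s t)%:R : R)%:E)
          * ((vol R d n)^-1)%:E)%E) @ \oo --> bhat%:E) /\
    {ae P, forall w,
        (fun n : nat => (pbetti q (restrictX (X w) n) s t)%:R / vol R d n)
          @ \oo --> bhat}.
Proof.
move=> Xrandom Xstat Xdep qd s0 st; have d_gt0 : (0 < d)%N by case: (d) qd.
have rankE n w : pbetti q (restrictX (X w) n) s t = local_rank X q s t n (fun=> 0) w.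
  by rewrite local_rank0; apply: pbetti_box_rank => //; case: Xrandom.
have [bhat [b0 bE bae]] := local_rank_lln q s t Xrandom Xstat Xdep d_gt0.
exists bhat; split=> //; split.
  (* The rank is bounded and measurable, so its extended-real integral is finite and equals the real
     mean. *)
  have E n : ((\int[P]_w ((pbetti q (restrictX (X w) n) s t)%:R : R)%:E) * ((vol R d n)^-1)%:E)%E =
      (Rintegral P setT (fun w => (local_rank X q s t n (fun=> 0) w)%:R) / vol R d n)%:E.
    rewrite EFinM; congr (_ * _)%E; rewrite /Rintegral fineK.
      by apply: eq_integral => w _; rewrite rankE.
    apply: integrable_fin_num => //; apply: bounded_measurable_integrable.
    apply: bounded_measurable_nat (local_rank_le X q s t n _) => U.
    exact: local_rank_measurable.
  under eq_fun do rewrite E.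
  by apply: cvg_EFin => //; exact: nearW.
apply: filterS bae => w; apply: cvg_trans; apply: near_eq_cvg; apply: nearW => n.
by rewrite rankE.
Qed.
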